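(* Let $0\le m_2\le m_1$, where $m_2=m_2(m_1)$ may depend on $m_1$, and let $W_{m_1,m_2}$, $T_{m_1,m_2}$ be the random variables of the card guessing game described in the context. As $m_1\to\infty$, the following convergences in distribution hold, depending on the growth behaviour of $m_2$; write $d:=m_1-m_2$. (1) If $m_2\sim\rho m_1$ with $0<\rho<1$: $(W_{m_1,m_2},T_{m_1,m_2})$ converges in distribution to a pair of discrete random variables $(\hat X_\rho,\hat Y_\rho)$ with joint probability mass function, for $k\ge 0$ and $\ell\ge 1$, $$ \mathbb{P}\{\hat X_\rho=k\wedge \hat Y_\rho=\ell\}= \begin{cases} \dfrac{\rho-\rho^{\ell}}{(1+\rho)^{\ell+1}}, & k=0,\ \ell\ge 1,\\[2ex] \dfrac{1-\rho}{\rho(1+\rho)}\left(\dfrac{\rho}{1+\rho}\right)^{\ell}\left(\dfrac{2\rho}{1+\rho}\right)^{k}, & k,\ell\ge 1. \end{cases} $$ In all other growth ranges, suitably scaled, the pair converges in distribution to a pair $(X,Y)$ of independent random variables: (2) If $m_2\ge 1$ is fixed: $\big(W_{m_1,m_2},\,T_{m_1,m_2}/m_1\big)\to (X,Y)$ with $X=0$ and $Y\sim\mathrm{Beta}(1,m_2)$, equivalently $Y$ is distributed as the minimum of $m_2$ independent random variables uniform on $[0,1]$. (3) If $m_2=o(m_1)$ and $m_2\to\infty$: $\big(W_{m_1,m_2},\,m_2T_{m_1,m_2}/m_1\big)\to(X,Y)$ with $X=0$ and $Y\sim\mathrm{Exp}(1)$. (4) If $m_2\sim m_1$ and $\sqrt{m_1}\ll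 d\ll m_1$: $\big(d\,W_{m_1,m_2}/m_1,\,T_{m_1,m_2}\big)\to(X,Y)$ with $X\sim\mathrm{Exp}(1/2)$ and $Y\sim\mathrm{Geom}(1/2)$ independent. (5) If $m_2\sim m_1$ and $d\sim\alpha\sqrt{m_1}$ with $\alpha>0$: $\big(W_{m_1,m_2}/\sqrt{m_1},\,T_{m_1,m_2}\big)\to(X,Y)$ with $X\sim\mathrm{LinExp}(\alpha/2,1/2)$ and $Y\sim\mathrm{Geom}(1/2)$ independent. (6) If $m_2\sim m_1$ and $d=o(\sqrt{m_1})$: $\big(W_{m_1,m_2}/\sqrt{m_1},\,T_{m_1,m_2}\big)\to(X,Y)$ with $X\sim\mathrm{Rayleigh}(\sqrt2)$ and $Y\sim\mathrm{Geom}(1/2)$ independent.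
   Context: Card guessing game: a deck consists of $m_1$ cards of one colour (red) and $m_2$ cards of another colour (black), with integers $0\le m_2\le m_1$, in uniformly random order. The cards are drawn from the top one at a time and discarded until the deck is empty. Before each draw the guesser knows the numbers of remaining red and black cards and guesses the colour of the next card so as to maximize the probability of being correct: the colour with strictly more remaining cards is guessed; if both colours have equally many remaining cards, either colour may be guessed (without information on the order of the remaining cards), with success probability $1/2$. $T_{m_1,m_2}$ is the number of correct guesses made with success probability $p=1$ (i.e. when only one colour remains). $W_{m_1,m_2}$ is the number of times during the process (including the initial state) at which the numbers of remaining red and black cards are equal and non-zero. Notation: $f\ll g$ means $f=o(g)$. $\mathrm{Exp}(\lambda)$ has distribution function $1-e^{-\lambda x}$, $x>0$. $\mathrm{Geom}(p)$ has probability mass function $p(1-p)^{\ell-1}$, $\ell\ge1$. $\mathrm{LinExp}(\lambda,\nu)$ has distribution function $1-e^{-(\lambda x+\nu x^2/2)}$, $x>0$. $\mathrm{Rayleigh}(\sigma)$ has distribution function $1-e^{-x^2/(2\sigma^2)}$, $x>0$. $\mathrm{Beta}(1,m)$ has distribution function $1-(1-y)^m$, $0<y<1$. *)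

(* Defs.v *)
From HB Require Import structures.
From mathcomp Require Import all_boot all_order all_algebra.
From mathcomp Require Import all_classical all_reals all_analysis.
Set Implicit Arguments.
Unset Strict Implicit.
Unset Printing Implicit Defensive.
Import Order.TTheory GRing.Theory Num.Theory.
Import numFieldNormedType.Exports.
Local Open Scope classical_set_scope.
Local Open Scope ring_scope.

(* A deck is the sequence of its colours from top to bottom. *)
Definition colour := bool.
Definition red : colour := true.
Definition black : colour := false.

Definition decks (m1 m2 : nat) : {set (m1 + m2).-tuple colour} :=
  [set w : (m1 + m2).-tuple colour | count_mem red w == m1]%SET.

Definition deck_prob (R : realType) (m1 m2 : nat) (A : pred (seq colour)) : R :=
  #|[set w in decks m1 m2 | A w]%SET|%:R / #|decks m1 m2|%:R.

Section Game.
(* The rule used at a tie may depend on the cards already seen only. *)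
Variables (tie : seq colour -> colour) (w : seq colour).

(* All quantities below refer to the moment when [j] cards have been drawn. *)
Definition remaining (c : colour) (j : nat) : nat := count_mem c (drop j w).

Definition guess (j : nat) : colour :=
  if (remaining black j < remaining red j)%N then red
  else if (remaining red j < remaining black j)%N then black
  else tie (take j w).

(* The remaining cards are in uniformly random order, so the next one has the
   guessed colour with this probability. *)
Definition success_probability (j : nat) : rat :=
  (remaining (guess j) j)%:R / (remaining red j + remaining black j)%:R.

Definition sure_guesses : nat :=
  count (fun j => (guess j == nth red w j) && (success_probability j == 1))
        (iota 0 (size w)).

Definition nonzero_ties : nat :=
  count (fun j => (remaining red j == remaining black j)
                  && (remaining red j != 0)%N)
        (iota 0 (size w).+1).

End Game.

Section RandomVariables.
Context (d : measure_display) (Om : measurableType d) (R : realType)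
  (P : probability Om R).

Definition joint_cdf (X Y : {RV P >-> R}) (z : R * R) : R :=
  fine (P [set w | X w <= z.1 /\ Y w <= z.2]).

Definition independent_pair (X Y : {RV P >-> R}) : Prop :=
  forall A B : set R, measurable A -> measurable B ->
    P (X @^-1` A `&` Y @^-1` B) = (P (X @^-1` A) * P (Y @^-1` B))%E.

(* Subfamilies are covered by taking [A i = setT] outside of them. *)
Definition independent_family (k : nat) (U : 'I_k -> {RV P >-> R}) : Prop :=
  forall A : 'I_k -> set R, (forall i, measurable (A i)) ->
    P (\bigcap_(i in [set: 'I_k]) (U i @^-1` A i))
    = (\prod_(i < k) P (U i @^-1` A i))%E.

Definition has_df (X : {RV P >-> R}) (F : R -> R) : Prop :=
  forall x, cdf X x = (F x)%:E.

Definition geometric_law (X : {RV P >-> R}) (p : R) : Prop :=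
  forall l : nat, (1 <= l)%N -> pmf X l%:R = p * (1 - p) ^+ l.-1.

Definition joint_pmf (X Y : {RV P >-> R}) (x y : R) : R :=
  fine (P [set w | X w = x /\ Y w = y]).

(* Convergence in distribution to [(X, Y)] of [Z m1], a pair of real functions
   of a uniformly random deck of [m1] red and [m2 m1] black cards, as
   [m1] tends to infinity: pointwise convergence of the joint distribution
   functions at the continuity points of the limit. *)
Definition cvg_in_distribution (m2 : nat -> nat)
    (Z : nat -> seq colour -> R * R) (X Y : {RV P >-> R}) : Prop :=
  forall z : R * R, {for z, continuous (joint_cdf X Y)} ->
    (deck_prob R m1 (m2 m1)
       (fun w => ((Z m1 w).1 <= z.1) && ((Z m1 w).2 <= z.2)) : R)
      @[m1 --> \oo] --> joint_cdf X Y z.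

End RandomVariables.

Section DistributionFunctions.
Context (R : realType).
Implicit Types x y : R.

Definition exp_df (lambda : R) x : R :=
  if 0 < x then 1 - expR (- (lambda * x)) else 0.

Definition linexp_df (lambda nu : R) x : R :=
  if 0 < x then 1 - expR (- (lambda * x + nu * x ^+ 2 / 2)) else 0.

Definition rayleigh_df (sigma : R) x : R :=
  if 0 < x then 1 - expR (- (x ^+ 2 / (2 * sigma ^+ 2))) else 0.

Definition beta1_df (m : nat) y : R :=
  if y <= 0 then 0 else if y < 1 then 1 - (1 - y) ^+ m else 1.

Definition limit_pmf (rho : R) (k l : nat) : R :=
  if k == 0 then (rho - rho ^+ l) / (1 + rho) ^+ l.+1
  else (1 - rho) / (rho * (1 + rho))
       * (rho / (1 + rho)) ^+ l * (2 * rho / (1 + rho)) ^+ k.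

End DistributionFunctions.

(* Main.v *)
Require Import Defs.
From HB Require Import structures.
From mathcomp Require Import all_boot all_order all_algebra.
From mathcomp Require Import all_classical all_reals all_analysis.
From mathcomp Require Import ring lra zify.

(** Read from the bottom, the deck is a path with a step up for a red card and a
    step down for a black one. The certain guesses are the cards of the first
    run of this path, whatever the rule used at ties ([sure_guessesE]), and the
    non-zero ties are its returns to zero.

    The joint upper tails are explicit. For [k, l >= 1] there are
    [2 ^ k * 'C(m1 + m2 + 1 - l - k, m1)] decks with at least [k] ties and at
    least [l] certain guesses ([deck_count_tail_event]): when the top card is
    removed this is Pascal's rule, and at a tie the two colours contribute the
    same number, which yields one factor 2 per tie. Decks with at least [l]
    certain guesses end with [l] cards of one colour ([deck_count_final_run]).
    By inclusion-exclusion the joint distribution function becomes a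
    combination of probabilities that the deck ends with [j] black or with [j]
    red cards ([deck_prob_below]).

    These probabilities are products of ratios such as
    [(m2 - i) / (m1 + m2 - i)], so each regime is the limit of a product.
    - If [m2 / m1] has a limit in (0, 1), the numbers of factors are fixed and
      the limits are powers ([proportional_regime]).
    - If [m2 / m1] tends to 0, ties disappear, and a red end of length [l] has
      probability about [(1 - l / m1) ^ m2], a power or an exponential
      according to whether [m2] is fixed ([rare_tie_regime]).
    - If [m2 / m1] tends to 1, the tail of the number of ties is the product
      over [i < k] of [1 - (m1 - m2 + i) / (m1 + m2 - i)], close to
      [expR (- (k (m1 - m2) / (2 m1) + k ^ 2 / (4 m1)))]
      ([cvg_tie_tail]). The three near-balanced regimes differ only in which
      of the two terms survive ([central_regime]). Prescribing [l] more cards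
      of the bottom block multiplies the tail by [(1 / 2) ^ l], hence the
      independent geometric law.

    The limit laws are Lebesgue-Stieltjes measures and countable mixtures of
    Dirac masses; independent pairs are the coordinates of a product space. *)

Set Implicit Arguments.
Unset Strict Implicit.
Unset Printing Implicit Defensive.
Import Order.TTheory GRing.Theory Num.Theory.
Import numFieldNormedType.Exports.
Local Open Scope classical_set_scope.
Local Open Scope ring_scope.

(** * The game in terms of the deck *)

Section Counting.
Local Open Scope nat_scope.

(** The length of the block of equal cards at the bottom of the deck, computed
    from the top so that it follows the same recursion as the game. *)
Fixpoint final_run (w : seq colour) : nat :=
  if w is c :: v then
    if all (pred1 c) v then size w else final_run v
  else 0.

Lemma count_red_black (w : seq colour) :
  count_mem red w + count_mem black w = size w.
Proof. by elim: w => //= -[] v /= <-; rewrite /red /black /=; lia. Qed.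

(** A tie with cards left has both colours remaining, so the tie rule cannot
    produce a certain guess; without a tie, certainty means that the majority
    colour is alone. *)
Lemma sure_first_guess (tie : seq colour -> colour) c v :
  (guess tie (c :: v) 0 == c) && (success_probability tie (c :: v) 0 == 1%R)
  = all (pred1 c) v.
Proof.
rewrite /success_probability /guess /remaining !drop0 take0.
have sz0 : 0 < count_mem red (c :: v) + count_mem black (c :: v).
  by rewrite count_red_black.
have probE (g : colour) : (((count_mem g (c :: v))%:R /
    (count_mem red (c :: v) + count_mem black (c :: v))%:R : rat) == 1)%R
    = (count_mem g (c :: v)
       == count_mem red (c :: v) + count_mem black (c :: v)).
  apply/eqP/eqP => [|->]; last by rewrite divff// pnatr_eq0 -lt0n.
  by move/divr1_eq/eqP; rewrite eqr_nat => /eqP.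
have -> : all (pred1 c) v = (count_mem c (c :: v)
       == count_mem red (c :: v) + count_mem black (c :: v)).
  by rewrite count_red_black all_count /= eqxx.
rewrite probE {probE}; move: sz0.
have c0 : 0 < count_mem c (c :: v) by rewrite /= eqxx.
move: c0; rewrite /red /black.
move aE : (count_mem true (c :: v)) => a.
move bE : (count_mem false (c :: v)) => b.
by case: c aE bE => aE bE; rewrite ?aE ?bE; case: (ltngtP b a);
  rewrite ?aE ?bE; try (case: (tie [::]); rewrite ?aE ?bE); rewrite /=; lia.
Qed.

Lemma sure_guessesE (tie : seq colour -> colour) w :
  sure_guesses tie w = final_run w.
Proof.
elim: w tie => [//|c v IH] tie.
have -> : sure_guesses tie (c :: v) =
    all (pred1 c) v + sure_guesses (fun s => tie (c :: s)) v.
  rewrite {1}/sure_guesses /= sure_first_guess; congr (_ + _).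
  by rewrite (iotaDl 1 0) count_map; apply: eq_count.
rewrite IH /=; case: ifP => // vc.
suff -> : final_run v = size v by rewrite add1n.
by case: v vc {IH} => //= a v /andP[/eqP-> ->].
Qed.

(** A tie of a non-empty deck is automatically a tie at a non-zero value, so the
    top card only matters through the equality of the two colour counts. *)
Lemma nonzero_ties_cons c v :
  nonzero_ties (c :: v)
  = (count_mem red (c :: v) == count_mem black (c :: v)) + nonzero_ties v.
Proof.
rewrite {1}/nonzero_ties.
have -> : iota 0 (size (c :: v)).+1 = 0 :: map (addn 1) (iota 0 (size v).+1).
  by rewrite -(iotaDl 1 0).
rewrite -[0 :: _]cat1s count_cat count_map [count _ [:: _]]/= addn0; congr (_ + _).
rewrite /remaining !drop0; case: eqP => //= E.
by have := count_red_black (c :: v); rewrite /= in E *; lia.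
Qed.

(** * Counting decks *)

(** Counting over all words of a given length, with the number of red cards as
    a mere condition on the word, lets the top card be removed without casts
    between the types of tuples indexed by the numbers of cards. *)
Definition nwords n (B : pred (seq colour)) : nat :=
  #|[set t : n.-tuple colour | B t]%SET|.

Lemma eq_nwords n (B1 B2 : pred (seq colour)) :
  (forall w, size w = n -> B1 w = B2 w) -> nwords n B1 = nwords n B2.
Proof.
by move=> B12; apply: eq_card => t; rewrite !inE B12// size_tuple.
Qed.

Lemma nwords0 B : nwords 0 B = B [::].
Proof.
rewrite /nwords; case: (boolP (B [::])) => B0.
  rewrite (_ : finset _ = finset.setT) ?cardsT ?card_tuple ?expn0//.
  by apply/setP => t; rewrite !inE tuple0.
rewrite (_ : finset _ = finset.set0) ?cards0//.
by apply/setP => t; rewrite !inE tuple0; apply/negbTE.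
Qed.

Lemma nwordsS n B :
  nwords n.+1 B = nwords n (fun w => B (red :: w))
                  + nwords n (fun w => B (black :: w)).
Proof.
have consE c : nwords n (fun w => B (c :: w))
    = #|[set t : n.+1.-tuple colour | B t & thead t == c]%SET|.
  rewrite /nwords -(card_imset _ (f := fun t : n.-tuple colour => [tuple of c :: t])).
    apply: eq_card => t; rewrite !inE; apply/imsetP/andP => [[u]|[Bt /eqP tc]].
      by rewrite inE => Bu ->; rewrite Bu theadE.
    exists (behead_tuple t); last by rewrite -tc -tuple_eta.
    by rewrite inE -tc; have := Bt; rewrite {1}(tuple_eta t).
  by move=> t u /(congr1 (@behead _ \o @tval _ _)) /= /val_inj.
rewrite !consE {1}/nwords -(cardsID [set t : n.+1.-tuple colour | thead t == red]%SET).
congr (_ + _); apply: eq_card => t; rewrite !inE //.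
by rewrite andbC; case: (thead t).
Qed.

Definition deck_count x y (A : pred (seq colour)) : nat :=
  nwords (x + y) (fun w => (count_mem red w == x) && A w).

Lemma eq_deck_count x y (A1 A2 : pred (seq colour)) :
  (forall w, count_mem red w = x -> count_mem black w = y -> A1 w = A2 w) ->
  deck_count x y A1 = deck_count x y A2.
Proof.
move=> A12; apply: eq_nwords => w; rewrite -count_red_black.
by case: eqP => //= wx /eqP; rewrite wx eqn_add2l => /eqP wy; exact: A12.
Qed.

Lemma deck_countS x y A : deck_count x.+1 y.+1 A
  = deck_count x y.+1 (fun w => A (red :: w))
    + deck_count x.+1 y (fun w => A (black :: w)).
Proof.
rewrite /deck_count addSn nwordsS; congr (_ + _).
by rewrite -addSnnS.
Qed.

Lemma nwords_false n : nwords n (fun=> false) = 0.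
Proof. by apply/eqP; rewrite cards_eq0; apply/eqP/setP => t; rewrite !inE. Qed.

Lemma nwords_const c x A :
  nwords x (fun w => all (pred1 c) w && A w) = A (nseq x c).
Proof.
elim: x A => [|x IH] A; first by rewrite nwords0.
by rewrite nwordsS /= -(IH (fun w => A (c :: w))); case: c {IH} => /=;
  rewrite nwords_false ?addn0.
Qed.

Lemma deck_count_red x A : deck_count x 0 A = A (nseq x red).
Proof.
rewrite -nwords_const /deck_count addn0; apply: eq_nwords => w <-.
by rewrite all_count.
Qed.

Lemma deck_count_black y A : deck_count 0 y A = A (nseq y black).
Proof.
rewrite -nwords_const /deck_count; apply: eq_nwords => w wy.
rewrite all_count -count_red_black.
by rewrite -[X in _ = (X == _) && _]add0n eqn_add2r eq_sym.
Qed.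

Lemma final_run_nseq c x : final_run (nseq x c) = x.
Proof. by case: x => //= x; rewrite all_pred1_nseq /= size_nseq. Qed.

Lemma nonzero_ties_nseq c x : nonzero_ties (nseq x c) = 0.
Proof.
elim: x => // x IH; rewrite -[nseq _ _]/(c :: nseq x c) nonzero_ties_cons IH.
by rewrite /= !count_nseq /red /black; case: c {IH} => /=; lia.
Qed.

Lemma final_run_cons c v : 0 < count_mem (~~ c) v ->
  final_run (c :: v) = final_run v.
Proof.
rewrite -has_count => /hasP[a av /eqP ac] /=; case: allP => // /(_ _ av).
by rewrite /= ac; case: (c).
Qed.

Definition tail_event k l : pred (seq colour) :=
  fun w => (k <= nonzero_ties w) && (l <= final_run w).

(** Discarding the top card does not affect the bottom block as long as both
    colours are present, and removes a tie exactly when the deck starts tied: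
    this is the recursion behind both counting formulas. *)
Lemma deck_count_tail_eventS x y k l :
  deck_count x.+1 y.+1 (tail_event k l)
  = deck_count x y.+1 (tail_event (k - (x == y)) l)
    + deck_count x.+1 y (tail_event (k - (x == y)) l).
Proof.
rewrite deck_countS; congr (_ + _); apply: eq_deck_count => w wr wb;
  rewrite /tail_event nonzero_ties_cons final_run_cons /=;
  rewrite -/red -/black ?wr ?wb //= leq_subLR;
  by rewrite ?add0n ?add1n ?eqSS.
Qed.

(** The last [l] cards are all red or all black; the remaining cards are
    arbitrary. The factors [l <= x] and [l <= y] are needed because the
    truncated subtraction would otherwise count one deck when a colour is
    absent. *)
Lemma deck_count_final_run x y l : 0 < l -> 0 < x + y ->
  deck_count x y (tail_event 0 l)
  = (l <= x) * 'C(x + y - l, y) + (l <= y) * 'C(x + y - l, x).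
Proof.
move=> l0; elim: x y => [|x IHx] y.
  rewrite deck_count_black /tail_event final_run_nseq bin0.
  by rewrite (leqNgt l 0) l0 mul0n muln1.
elim: y => [|y IHy] _.
  rewrite deck_count_red /tail_event final_run_nseq bin0.
  by rewrite (leqNgt l 0) l0 mul0n muln1 addn0.
rewrite deck_count_tail_eventS sub0n IHx ?addnS // -addnS IHy ?addSn // -addSn -addnS.
have half a b : (l <= a.+1) * 'C(a.+1 + b.+1 - l, b.+1)
    = (l <= a) * 'C(a + b.+1 - l, b.+1) + (l <= a.+1) * 'C(a.+1 + b - l, b).
  (* At [l = a.+1] one deck remains on both sides. *)
  case: (ltngtP l a.+1) => [la|la|->].
  - rewrite -ltnS la !mul1n (_ : a.+1 + b.+1 - l = (a + b.+1 - l).+1).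
      by rewrite binS addSnnS.
    by lia.
  - by rewrite leqNgt (ltnW la) !mul0n.
  - rewrite ltnn mul0n !mul1n add0n.
    by rewrite !addKn !binn.
have := half y x; rewrite ![y.+1 + _]addnC [y + _]addnC half => ->.
by rewrite addnACA [X in _ + X]addnC.
Qed.

(** Off the diagonal, removing the top card is Pascal's rule for the binomial
    coefficient. On the diagonal, red and black tops contribute equally by
    symmetry, which gives the factor 2, while the tie itself lowers the
    required number of ties by one, so that the upper argument of the binomial
    coefficient does not change. In terms of the path read from the bottom,
    every return to zero is traded for a lost step and a free choice of
    sign. *)
Lemma deck_count_tail_event x y k l : 0 < k -> 0 < l -> 0 < x + y ->
  deck_count x y (tail_event k l) = 2 ^ k * 'C(x + y + 1 - l - k, maxn x y).
Proof.
move=> k0 l0; elim: x y k k0 => [|x IHx] y k k0.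
  case: y => // y _; rewrite deck_count_black /tail_event nonzero_ties_nseq.
  by rewrite leqNgt k0 bin_small ?muln0 //; lia.
elim: y k k0 => [|y IHy] k k0 _.
  rewrite deck_count_red /tail_event nonzero_ties_nseq.
  by rewrite leqNgt k0 bin_small ?muln0 //; lia.
rewrite deck_count_tail_eventS; case: (ltngtP x y) => [xy|yx|xy].
- rewrite subn0 IHx ?addn_gt0 ?orbT // IHy // -mulnDr; congr (_ * _).
  have [-> -> ->] : [/\ maxn x y.+1 = y.+1, maxn x.+1 y = y
    & maxn x.+1 y.+1 = y.+1] by split; lia.
  have [N0|N0] := posnP (x.+1 + y.+1 + 1 - l - k).
    by rewrite !bin_small //; lia.
  rewrite (_ : x.+1 + y.+1 + 1 - l - k = (x + y.+1 + 1 - l - k).+1); last lia.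
  by rewrite binS addSnnS.
- rewrite subn0 IHx ?addn_gt0 ?orbT // IHy // -mulnDr; congr (_ * _).
  have [-> -> ->] : [/\ maxn x y.+1 = x, maxn x.+1 y = x.+1
    & maxn x.+1 y.+1 = x.+1] by split; lia.
  have [N0|N0] := posnP (x.+1 + y.+1 + 1 - l - k).
    by rewrite !bin_small //; lia.
  rewrite (_ : x.+1 + y.+1 + 1 - l - k = (x + y.+1 + 1 - l - k).+1); last lia.
  by rewrite binS addnC addSnnS.
- subst y; rewrite maxnn; case: k k0 => [//|[|k]] _.
    rewrite subnn !deck_count_final_run ?addn_gt0 ?orbT // expn1.
    rewrite (_ : x.+1 + x - l = x + x.+1 - l); last lia.
    case: (ltngtP l x.+1) => [lx|lx|->].
    + rewrite -ltnS lx !mul1n.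
      rewrite (_ : x.+1 + x.+1 + 1 - l - 1 = (x + x.+1 - l).+1); last lia.
      by rewrite binS; lia.
    + by rewrite leqNgt (ltnW lx) !mul0n bin_small ?muln0 //; lia.
    + rewrite ltnn addnK binn (_ : x.+1 + x.+1 + 1 - x.+1 - 1 = x.+1) ?binn //.
      lia.
  rewrite subn1 /= IHx ?addn_gt0 ?orbT // IHy // (maxn_idPr _) // (maxn_idPl _) //.
  rewrite (addSnnS x x) addnn -mul2n mulnA -expnS.
  congr (_ * 'C(_, _)); lia.
Qed.

Lemma final_run_gt0 w : 0 < size w -> 0 < final_run w.
Proof.
elim: w => //= c v IH _; case: ifPn => // nall; apply: IH.
by case: v nall.
Qed.

Lemma deck_count_predT x y : deck_count x y predT = 'C(x + y, x).
Proof.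
elim: x y => [|x IHx] y; first by rewrite deck_count_black bin0.
elim: y => [|y IHy]; first by rewrite deck_count_red addn0 binn.
by rewrite deck_countS IHx IHy -addSnnS addSn addnS binS addnC.
Qed.

Lemma nwordsE n B : nwords n B = \sum_(t : n.-tuple colour) B t.
Proof.
rewrite /nwords cardsE -sum1_card [LHS]big_mkcond; apply: eq_bigr => t _.
by rewrite unfold_in; case: (B t).
Qed.

Lemma deck_count_inclusion_exclusion x y (A B : pred (seq colour)) :
  deck_count x y (fun w => ~~ A w && ~~ B w) + deck_count x y A
    + deck_count x y B
  = deck_count x y predT + deck_count x y (fun w => A w && B w).
Proof.
rewrite /deck_count !nwordsE -!big_split; apply: eq_bigr => t _ /=.
by case: eqP; case: (A t); case: (B t).
Qed.

End Counting.

Section DeckProb.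
Variable R : realType.

(** The probability that the last [j] cards of a deck of [x] red and [y] black
    cards are all black; [black_end y x j] is the one for red cards, by the
    symmetry of the colours. *)
Definition black_end x y j : R :=
  'C(x + y - j, x)%:R / 'C(x + y, x)%:R.

Lemma deck_probE x y A :
  deck_prob R x y A = (deck_count x y A)%:R / 'C(x + y, x)%:R.
Proof.
rewrite /deck_prob -deck_count_predT; congr (_%:R / _%:R).
  by apply: eq_card => w; rewrite !inE.
by apply: eq_card => w; rewrite !inE andbT.
Qed.

(** Inclusion-exclusion applied to the two upper tails. The tail of the number
    of ties is the joint tail at [l = 1], because a non-empty deck always has a
    non-empty bottom block. *)
Definition below_prob x y k l : R :=
  1 - 2 ^+ k * black_end x y k - (black_end x y l + black_end y x l)
    + 2 ^+ k * black_end x y (k + l - 1).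

Lemma deck_prob_below x y k l : (0 < y <= x)%N -> (0 < k)%N -> (0 < l)%N ->
  deck_prob R x y (fun w => (nonzero_ties w < k)%N && (final_run w < l)%N)
  = below_prob x y k l.
Proof.
move=> /andP[y0 yx] k0 l0; rewrite /below_prob.
have xy0 : (0 < x + y)%N by rewrite addn_gt0 y0 orbT.
have := deck_count_inclusion_exclusion x y
  (fun w => k <= nonzero_ties w)%N (fun w => l <= final_run w)%N.
under eq_deck_count do rewrite -!ltnNge.
rewrite deck_count_predT deck_probE (deck_count_tail_event k0 l0 xy0).
rewrite (eq_deck_count (A1 := fun w => (k <= nonzero_ties w)%N)
  (A2 := tail_event k 1)); last first.
  move=> w wr wb.
  by rewrite /tail_event final_run_gt0 ?andbT // -count_red_black wr wb.
rewrite (deck_count_tail_event k0 (ltn0Sn 0) xy0).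
rewrite (eq_deck_count (A1 := fun w => (l <= final_run w)%N)
  (A2 := tail_event 0 l)) // (deck_count_final_run l0 xy0) (maxn_idPl yx).
set c := deck_count _ _ _ => E.
have C0 : 'C(x + y, x)%:R != 0 :> R.
  by rewrite pnatr_eq0 -lt0n bin_gt0 leq_addr.
have Ey : ((l <= x) * 'C(x + y - l, y))%N = 'C(x + y - l, y).
  by case: leqP => lx; rewrite ?mul1n // bin_small //; lia.
have Ex : ((l <= y) * 'C(x + y - l, x))%N = 'C(x + y - l, x).
  by case: leqP => ly; rewrite ?mul1n // bin_small //; lia.
move: E; rewrite {}Ex {}Ey => /(congr1 (fun n => n%:R : R)).
rewrite !natrD !natrM !natrX.
rewrite (_ : x + y + 1 - 1 - k = x + y - k)%N; last lia.
rewrite (_ : x + y + 1 - l - k = x + y - (k + l - 1))%N; last lia.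
have Cyx : 'C(x + y, y) = 'C(x + y, x).
  by rewrite -(bin_sub (leq_addl x y)) addnK.
rewrite /black_end (addnC y x) Cyx => E.
apply: (mulIf C0); rewrite mulfVK // !(mulrDl, mulrBl, mulNr) -!mulrA !mulVf//.
by rewrite !mulr1 mul1r; lra.
Qed.
End DeckProb.

(** * Product formulas and exponential bounds *)

Section BlackEnd.
Variable R : realType.
Implicit Types x y j k : nat.

(** Card by card from the bottom: given that the last [k + i] cards are black,
    the next one is black with probability the ratio of the remaining
    numbers. *)
Lemma black_end_add x y k j : (0 < x)%N ->
  black_end R x y (k + j) = black_end R x y k *
    \prod_(i < j) ((y - (k + i))%N%:R / (x + y - (k + i))%N%:R).
Proof.
move=> x0; elim: j => [|j IH]; first by rewrite big_ord0 addn0 mulr1.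
rewrite big_ord_recr /= !mulrA -{}IH /black_end [_ / _ * _]mulrAC.
rewrite [RHS]mulrAC; congr (_ / _).
set N := (x + y - (k + j))%N.
have -> : (x + y - (k + j.+1) = N.-1)%N by lia.
have [N0|N0] := posnP N.
  by rewrite N0 bin_small // invr0 !mulr0.
have N0' : N%:R != 0 :> R by rewrite pnatr_eq0 -lt0n.
apply: (mulIf N0'); rewrite mulfVK // -!natrM mulnC mul_bin_down.
by rewrite mulnC; congr ((_ * _)%:R); lia.
Qed.

Lemma black_end0 x y : black_end R x y 0 = 1.
Proof. by rewrite /black_end subn0 divff // pnatr_eq0 -lt0n bin_gt0 leq_addr. Qed.

Lemma black_end_prod x y j : (0 < x)%N ->
  black_end R x y j = \prod_(i < j) ((y - i)%N%:R / (x + y - i)%N%:R).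
Proof. by move=> x0; rewrite -[j]add0n black_end_add // black_end0 mul1r. Qed.

(** The same probability, counted by the positions of the red cards instead of
    by the colours of the last cards. This form has a number of factors that
    does not depend on [j], as needed when few black cards face a long red
    end. *)
Lemma black_end_prod_red x y j :
  black_end R x y j
  = \prod_(i < x) ((x + y - j - i)%N%:R / (x + y - i)%N%:R).
Proof.
have fact0 : x`!%:R != 0 :> R by rewrite pnatr_eq0 -lt0n fact_gt0.
rewrite prodf_div -!natr_prod -!ffact_prod -!bin_ffact !natrM /black_end.
by rewrite -mulf_div divff // mulr1.
Qed.

Lemma black_end_ge0 x y j : 0 <= black_end R x y j.
Proof. by rewrite /black_end divr_ge0. Qed.

Lemma black_end_le x y j : (0 < x)%N -> (0 < j)%N ->
  black_end R x y j <= y%:R / (x + y)%:R.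
Proof.
move=> x0; case: j => // j _; rewrite -add1n black_end_add //.
rewrite black_end_prod // big_ord1 !subn0 ler_piMr // ?divr_ge0 //.
apply: prodr_ile1 => i _; rewrite divr_ge0 //=.
have [->|D0] := posnP (x + y - (1 + i)); first by rewrite invr0 mulr0.
by rewrite ler_pdivrMr ?ltr0n // mul1r ler_nat; lia.
Qed.

(** Both sides are [1 + t <= expR t], applied to [u / v] and to [v / u]. Being
    multiplicative, these bounds pass to products without error terms. *)
Lemma ratio_expR_bounds (u v : R) : 0 < u -> 0 < v ->
  expR ((u - v) / u) <= u / v <= expR ((u - v) / v).
Proof.
move=> u0 v0; apply/andP; split.
  rewrite -[leRHS]invrK -[leLHS]invrK lef_pV2 ?posrE ?invr_gt0 ?expR_gt0 ?divr_gt0 //.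
  rewrite -expRN invf_div (le_trans _ (expR_ge1Dx _)) //.
  rewrite -mulNr opprB mulrBl divff ?gt_eqF //; lra.
rewrite (le_trans _ (expR_ge1Dx _)) //.
rewrite mulrBl divff ?gt_eqF //; lra.
Qed.

Lemma prod_expR_bounds n (f g h : 'I_n -> R) :
  (forall i, expR (f i) <= g i <= expR (h i)) ->
  expR (\sum_i f i) <= \prod_i g i <= expR (\sum_i h i).
Proof.
move=> fgh; rewrite !expR_sum; apply/andP; split; apply: ler_prod => i _;
  have /andP[fg gh] := fgh i; rewrite ?expR_ge0 ?fg ?gh ?andbT //.
exact: le_trans fg.
Qed.

(** The sum of [(x - y) + i] over [i < k]: the first-order exponent of the
    product of the factors [1 - (x - y + i) / (x + y - i)]. *)
Definition tie_exponent x y k : R :=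
  k%:R * (x%:R - y%:R) + 'C(k, 2)%:R.

(** The factor 2 for each tie turns the ratio [(y - i) / (x + y - i)] into
    [1 - (x - y + i) / (x + y - i)], which is close to 1 near the diagonal: this
    is why the number of ties lives on a growing scale there. *)
Lemma tie_tail_bounds x y k : (y <= x)%N -> (k < y)%N ->
  expR (- (tie_exponent x y k / (2 * (y%:R - k%:R))))
    <= 2 ^+ k * black_end R x y k
    <= expR (- (tie_exponent x y k / (x%:R + y%:R))).
Proof.
move=> yx ky.
have SE : tie_exponent x y k = \sum_(i < k) (x%:R - y%:R + i%:R).
  rewrite /tie_exponent -bin2_sum big_mkord natr_sum.
  by rewrite big_split /= sumr_const card_ord mulr_natl.
have -> : 2 ^+ k * black_end R x y k = \prod_(i < k)
    (2 * (y%:R - i%:R) / (x%:R + y%:R - i%:R)).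
  rewrite black_end_prod; last lia.
  rewrite -[X in 2 ^+ X]card_ord -prodr_const -big_split /=.
  apply: eq_bigr => i _; rewrite mulrA !natrB ?natrD //; have := ltn_ord i; lia.
rewrite SE -!mulNr -!sumrN !mulr_suml.
have kyR : k%:R < y%:R :> R by rewrite ltr_nat.
have yxR : y%:R <= x%:R :> R by rewrite ler_nat.
apply: prod_expR_bounds => i.
have ikR : i%:R < k%:R :> R by rewrite ltr_nat.
have i0 : 0 <= i%:R :> R by [].
have [u0 v0] : 0 < 2 * (y%:R - i%:R) :> R /\ 0 < x%:R + y%:R - i%:R :> R.
  by split; lra.
have /andP[lo hi] := ratio_expR_bounds u0 v0.
have uvE : 2 * (y%:R - i%:R) - (x%:R + y%:R - i%:R)
    = - (x%:R - y%:R + i%:R) :> R by ring.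
rewrite uvE in lo hi; apply/andP; split.
  apply: le_trans lo; rewrite ler_expR.
  rewrite !mulNr lerN2 ler_wpM2l //; first lra.
  by rewrite lef_pV2 ?posrE; lra.
apply: le_trans hi _; rewrite ler_expR.
rewrite !mulNr lerN2 ler_wpM2l //; first lra.
by rewrite lef_pV2 ?posrE; lra.
Qed.

Lemma red_end_bounds x y j : (j < x)%N ->
  expR (- (y%:R * j%:R / (x%:R - j%:R))) <= black_end R y x j
    <= expR (- (y%:R * j%:R / (x%:R + y%:R))).
Proof.
move=> jx; rewrite black_end_prod_red.
have -> : - (y%:R * j%:R / (x%:R - j%:R))
    = \sum_(i < y) - (j%:R / (x%:R - j%:R)) :> R.
  by rewrite sumr_const card_ord mulNrn -mulrA mulr_natl.
have -> : - (y%:R * j%:R / (x%:R + y%:R))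
    = \sum_(i < y) - (j%:R / (x%:R + y%:R)) :> R.
  by rewrite sumr_const card_ord mulNrn -mulrA mulr_natl.
apply: prod_expR_bounds => i.
have iy := ltn_ord i.
rewrite !natrB ?natrD; try lia.
have iyR : i%:R < y%:R :> R by rewrite ltr_nat.
have jxR : j%:R < x%:R :> R by rewrite ltr_nat.
have i0 : 0 <= i%:R :> R by [].
have j0 : 0 <= j%:R :> R by [].
have [u0 v0] : 0 < y%:R + x%:R - j%:R - i%:R :> R /\ 0 < y%:R + x%:R - i%:R :> R.
  by split; lra.
have /andP[lo hi] := ratio_expR_bounds u0 v0.
have uvE : y%:R + x%:R - j%:R - i%:R - (y%:R + x%:R - i%:R) = - j%:R :> R.
  by ring.
rewrite uvE in lo hi.
apply/andP; split.
  apply: le_trans lo; rewrite ler_expR !mulNr lerN2 ler_wpM2l //.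
  by rewrite lef_pV2 ?posrE; lra.
apply: le_trans hi _; rewrite ler_expR !mulNr lerN2 ler_wpM2l //.
by rewrite lef_pV2 ?posrE; lra.
Qed.
End BlackEnd.

(** * Limits of the tails *)

Section Limits.
Variable R : realType.

Lemma cvg_near_eq (f g : nat -> R) (l : R) :
  (\forall m \near \oo, f m = g m) -> g m @[m --> \oo] --> l ->
  f m @[m --> \oo] --> l.
Proof. by move=> fg; apply: cvg_trans; apply: near_eq_cvg; apply: filterS fg => ? ->. Qed.

Lemma near_gt0 : \forall m \near \oo, (0 < m)%N.
Proof. by exists 1%N. Qed.

Lemma cvg_invn : (m%:R^-1 : R) @[m --> \oo] --> (0 : R).
Proof.
apply/gtr0_cvgV0; last exact: cvgr_idn.
by near do rewrite ltr0n; exact: near_gt0.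
Unshelve. all: by end_near. Qed.

Lemma cvg_cst_divn (c : R) : (c / m%:R) @[m --> \oo] --> (0 : R).
Proof. by rewrite -(mulr0 c); apply: cvgMr => //; exact: cvg_invn. Qed.

Lemma cvg_divnn : ((m%:R / m%:R) : R) @[m --> \oo] --> (1 : R).
Proof.
apply: (@cvg_near_eq _ (fun=> 1)); last exact: cvg_cst.
near=> m; rewrite divff // pnatr_eq0 -lt0n; near: m; exact: near_gt0.
Unshelve. all: by end_near. Qed.

Lemma cvg_expR (f : nat -> R) l : f m @[m --> \oo] --> l ->
  expR (f m) @[m --> \oo] --> expR l.
Proof. by apply: continuous_cvg; exact: continuous_expR. Qed.

Lemma cvg_prod_ord n (f : 'I_n -> nat -> R) (l : 'I_n -> R) :
  (forall i, f i m @[m --> \oo] --> l i) ->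
  (\prod_(i < n) f i m) @[m --> \oo] --> \prod_(i < n) l i.
Proof. by move=> fl; apply: cvg_big => //; exact: mul_continuous. Qed.

Lemma cvg_subn_ratio (u v : nat -> nat) (r s : R) :
  (u m)%:R / m%:R @[m --> \oo] --> r ->
  (v m)%:R / m%:R @[m --> \oo] --> s ->
  (u m - v m)%N%:R / m%:R @[m --> \oo] --> Num.max (r - s) 0.
Proof.
move=> ur vs.
rewrite (_ : (fun m => _) = fun m => Num.max ((u m)%:R / m%:R - (v m)%:R / m%:R) 0).
  apply: (@continuous_cvg _ _ _ _ _ _ (fun x : R => Num.max x 0)).
    by apply: continuous_max; [exact: cvg_id|exact: cvg_cst].
  exact: cvgB.
apply/funext => m; have [->|m0] := posnP m; first by rewrite invr0 !mulr0 subrr maxxx.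
rewrite -mulrBl; case: (leqP (v m) (u m)) => uv.
  rewrite natrB // max_l // divr_ge0 // subr_ge0 ler_nat //.
rewrite (eqP (ltnW uv)) mul0r max_r // pmulr_lle0 ?invr_gt0 ?ltr0n //.
by rewrite subr_le0 ler_nat ltnW.
Qed.

(** Truncated subtraction becomes a maximum with 0 in the limit; this is the
    point where a threshold beyond the whole deck is taken into account. *)
Lemma cvg_sub_quotient (u u' v v' : nat -> nat) (r r' s s' : R) :
  (u m)%:R / m%:R @[m --> \oo] --> r ->
  (v m)%:R / m%:R @[m --> \oo] --> s ->
  (u' m)%:R / m%:R @[m --> \oo] --> r' ->
  (v' m)%:R / m%:R @[m --> \oo] --> s' -> s' < r' ->
  ((u m - v m)%N%:R / (u' m - v' m)%N%:R) @[m --> \oo]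
    --> Num.max (r - s) 0 / (r' - s').
Proof.
move=> ur vs ur' vs' sr'.
have sr0 : 0 < r' - s' by rewrite subr_gt0.
apply: (@cvg_near_eq _ (fun m => ((u m - v m)%N%:R / m%:R) /
   ((u' m - v' m)%N%:R / m%:R))).
  near=> m; rewrite invf_div mulrA mulfVK // pnatr_eq0 -lt0n.
  by near: m; exact: near_gt0.
apply: cvgM; first exact: cvg_subn_ratio.
apply: cvgV; first by rewrite gt_eqF.
by rewrite -[X in _ --> X](max_l (ltW sr0)); exact: cvg_subn_ratio.
Unshelve. all: by end_near. Qed.

Lemma cvg_shift_quotient (u u' v v' : nat -> nat) (r r' : R) :
  0 <= r -> 0 < r' ->
  (u m)%:R / m%:R @[m --> \oo] --> r ->
  (v m)%:R / m%:R @[m --> \oo] --> (0 : R) ->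
  (u' m)%:R / m%:R @[m --> \oo] --> r' ->
  (v' m)%:R / m%:R @[m --> \oo] --> (0 : R) ->
  ((u m - v m)%N%:R / (u' m - v' m)%N%:R) @[m --> \oo] --> r / r'.
Proof.
move=> r0 r0' ur vs ur' vs'; have := cvg_sub_quotient ur vs ur' vs' r0'.
by rewrite !subr0 max_l.
Qed.

Lemma cvg_addn_ratio (u v : nat -> nat) (r s : R) :
  (u m)%:R / m%:R @[m --> \oo] --> r ->
  (v m)%:R / m%:R @[m --> \oo] --> s ->
  (u m + v m)%N%:R / m%:R @[m --> \oo] --> r + s.
Proof.
move=> ur vs; under eq_fun do rewrite natrD mulrDl.
exact: cvgD.
Qed.

Lemma cvg_addc_ratio (u : nat -> nat) n (r : R) :
  (u m)%:R / m%:R @[m --> \oo] --> r ->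
  (u m + n)%N%:R / m%:R @[m --> \oo] --> r.
Proof.
move=> ur; rewrite -[X in _ --> X]addr0.
by apply: (cvg_addn_ratio (v := fun=> n)) => //; exact: cvg_cst_divn.
Qed.

Section Decks.
Variable m2 : nat -> nat.
Let b m j : R := black_end R m (m2 m) j.
Let a m j : R := black_end R (m2 m) m j.

(** After [o(m)] black cards at the bottom the proportions of the colours have
    not moved, so [j] further black cards cost a factor [r / (1 + r)] each. In
    the near-balanced regimes this is the asymptotic independence of the number
    of ties and of the bottom block. *)
Lemma cvg_black_end_add (k : nat -> nat) j (r : R) : 0 <= r ->
  (m2 m)%:R / m%:R @[m --> \oo] --> r ->
  (k m)%:R / m%:R @[m --> \oo] --> (0 : R) ->
  forall l : R, 2 ^+ k m * b m (k m) @[m --> \oo] --> l ->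
  2 ^+ k m * b m (k m + j) @[m --> \oo] --> l * (r / (1 + r)) ^+ j.
Proof.
move=> r0 m2r k0 l bl.
apply: (@cvg_near_eq _ (fun m => 2 ^+ k m * b m (k m) * \prod_(i < j)
    ((m2 m - (k m + i))%N%:R / (m + m2 m - (k m + i))%N%:R))).
  near=> m; rewrite /b black_end_add ?mulrA //.
  by near: m; exact: near_gt0.
apply: cvgM => //.
rewrite -[j in X in _ --> X]card_ord -prodr_const.
apply: cvg_prod_ord => i.
apply: cvg_shift_quotient => //; [|exact: cvg_addc_ratio| |exact: cvg_addc_ratio].
- by rewrite ltr_wpDr.
- by apply: cvg_addn_ratio => //; exact: cvg_divnn.
Unshelve. all: by end_near. Qed.

Lemma cvg_black_end j (r : R) : 0 <= r ->
  (m2 m)%:R / m%:R @[m --> \oo] --> r ->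
  b m j @[m --> \oo] --> (r / (1 + r)) ^+ j.
Proof.
move=> r0 m2r; have := @cvg_black_end_add (fun=> 0%N) j r r0 m2r.
move=> /(_ (cvg_cst_divn _) 1); under eq_fun do rewrite /b black_end0 mul1r.
rewrite mul1r => /(_ (cvg_cst _)).
by under eq_fun do rewrite mul1r add0n.
Qed.

Lemma cvg_red_end j (r : R) : 0 <= r ->
  (\forall m \near \oo, (0 < m2 m)%N) ->
  (m2 m)%:R / m%:R @[m --> \oo] --> r ->
  a m j @[m --> \oo] --> (1 / (1 + r)) ^+ j.
Proof.
move=> r0 m20 m2r.
apply: (@cvg_near_eq _ (fun m => \prod_(i < j)
    ((m - i)%N%:R / (m + m2 m - i)%N%:R))).
  near=> m; rewrite /a black_end_prod; last by near: m.
  by apply: eq_bigr => i _; rewrite addnC.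
rewrite -[j in X in _ --> X]card_ord -prodr_const.
apply: cvg_prod_ord => i.
apply: cvg_shift_quotient; [by []|by rewrite ltr_wpDr|exact: cvg_divnn
  |exact: cvg_cst_divn| |exact: cvg_cst_divn].
by apply: cvg_addn_ratio => //; exact: cvg_divnn.
Unshelve. all: by end_near. Qed.

Lemma bin2_natr k : 'C(k, 2)%:R = (k%:R ^+ 2 - k%:R) / 2 :> R.
Proof.
case: k => [|k]; first by rewrite expr0n subrr mul0r.
have /(congr1 (fun n => n%:R : R)) := mul_bin_diag k.+1 1.
rewrite /= bin1 !natrM -natr1 => E; lra.
Qed.

(** The bounds of [tie_tail_bounds] have the same limit: [k (m - m2) / m]
    measures the drift and [k ^ 2 / m] the diffusive part of the exponent. *)
Lemma cvg_tie_tail (k : nat -> nat) (al be : R) :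
  (\forall m \near \oo, (m2 m <= m)%N) ->
  (m2 m)%:R / m%:R @[m --> \oo] --> (1 : R) ->
  (k m)%:R / m%:R @[m --> \oo] --> (0 : R) ->
  (k m)%:R * (m%:R - (m2 m)%:R) / m%:R @[m --> \oo] --> al ->
  (k m)%:R ^+ 2 / m%:R @[m --> \oo] --> be ->
  2 ^+ k m * b m (k m) @[m --> \oo] --> expR (- (al / 2 + be / 4)).
Proof.
move=> m2m m2r k0 kal kbe.
pose e m := tie_exponent R m (m2 m) (k m) / m%:R.
have e_cvg : e m @[m --> \oo] --> al + be / 2.
  rewrite (_ : e = fun m => (k m)%:R * (m%:R - (m2 m)%:R) / m%:R
      + ((k m)%:R ^+ 2 / m%:R - (k m)%:R / m%:R) / 2).
    by apply: cvgD => //; apply: cvgMl; rewrite -[be]subr0; exact: cvgB.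
  by apply/funext => m; rewrite /e /tie_exponent bin2_natr; ring.
have limE : - (al / 2 + be / 4) = - ((al + be / 2) / (2 * (1 - 0))).
  by rewrite subr0 mulr1 mulrDl; congr (- (_ + _)); field.
have limE' : - (al / 2 + be / 4) = - ((al + be / 2) / (1 + 1)).
  by rewrite mulrDl; congr (- (_ + _)); field.
apply: (@squeeze_cvgr _ _ _ _
  (fun m => expR (- (e m / (2 * ((m2 m)%:R / m%:R - (k m)%:R / m%:R)))))
  (fun m => expR (- (e m / (m%:R / m%:R + (m2 m)%:R / m%:R))))).
- near=> m.
  have m0 : m%:R != 0 :> R by rewrite pnatr_eq0 -lt0n; near: m; exact: near_gt0.
  have cancel (x y : R) : x / m%:R / (y / m%:R) = x / y.
    by rewrite invf_div mulrA mulfVK.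
  rewrite -mulrBl -mulrDl mulrA /e !cancel; apply: tie_tail_bounds.
    by near: m.
  have m0' : 0 < m%:R :> R by rewrite lt0r m0 /=.
  rewrite -(ltr_nat R) -(ltr_pM2r (x := m%:R^-1)) ?invr_gt0 //.
  apply: (@lt_trans _ _ (1 / 2)).
    by near: m; apply: (cvgr_lt _ k0); lra.
  by near: m; apply: (cvgr_gt _ m2r); lra.
- apply: cvg_expR; rewrite limE; apply: cvgN; apply: cvgM => //.
  apply: cvgV; first by rewrite subr0 mulr1.
  by apply: cvgMr; exact: cvgB.
- apply: cvg_expR; rewrite limE'; apply: cvgN; apply: cvgM => //.
  apply: cvgV => //.
  by apply: cvgD => //; exact: cvg_divnn.
Unshelve. all: by end_near. Qed.

(** Each of the [m2] black cards misses the last [l] positions with probability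
    about [1 - l / m]. *)
Lemma cvg_red_end_expR (l : nat -> nat) (c : R) :
  (m2 m)%:R / m%:R @[m --> \oo] --> (0 : R) ->
  (l m)%:R / m%:R @[m --> \oo] --> (0 : R) ->
  (m2 m)%:R * (l m)%:R / m%:R @[m --> \oo] --> c ->
  a m (l m) @[m --> \oo] --> expR (- c).
Proof.
move=> m20 l0 lc.
pose e m : R := (m2 m)%:R * (l m)%:R / m%:R.
apply: (@squeeze_cvgr _ _ _ _
  (fun m => expR (- (e m / (m%:R / m%:R - (l m)%:R / m%:R))))
  (fun m => expR (- (e m / (m%:R / m%:R + (m2 m)%:R / m%:R))))).
- near=> m.
  have m0 : m%:R != 0 :> R by rewrite pnatr_eq0 -lt0n; near: m; exact: near_gt0.
  have cancel (x y : R) : x / m%:R / (y / m%:R) = x / y.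
    by rewrite invf_div mulrA mulfVK.
  rewrite -mulrBl -mulrDl /e !cancel; apply: red_end_bounds.
  have m0' : 0 < m%:R :> R by rewrite lt0r m0 /=.
  rewrite -(ltr_nat R) -(ltr_pM2r (x := m%:R^-1)) ?invr_gt0 // divff //.
  by near: m; apply: (cvgr_lt _ l0).
- apply: cvg_expR; rewrite -[c]divr1 -[in X in c / X](subr0 1).
  apply: cvgN; apply: cvgM => //; apply: cvgV; first by rewrite subr0.
  by apply: cvgB => //; exact: cvg_divnn.
- apply: cvg_expR; rewrite -[c]divr1 -[in X in c / X](addr0 1).
  apply: cvgN; apply: cvgM => //; apply: cvgV; first by rewrite addr0.
  by apply: cvgD => //; exact: cvg_divnn.
Unshelve. all: by end_near. Qed.

Lemma cvg_red_end_pow k (l : nat -> nat) (c : R) :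
  (l m)%:R / m%:R @[m --> \oo] --> c ->
  black_end R k m (l m) @[m --> \oo] --> Num.max (1 - c) 0 ^+ k.
Proof.
move=> lc; rewrite -[k in X in _ --> X]card_ord -prodr_const.
under eq_fun do rewrite black_end_prod_red.
apply: cvg_prod_ord => i.
have km : (k + m)%N%:R / m%:R @[m --> \oo] --> (1 : R).
  under eq_fun do rewrite addnC.
  by apply: (cvg_addc_ratio (u := id)); exact: cvg_divnn.
have := cvg_sub_quotient km (cvg_addc_ratio i lc) km (cvg_cst_divn i%:R).
rewrite subr0 divr1 => /(_ ltr01).
by under eq_fun do rewrite subnDA.
Qed.

End Decks.
End Limits.

(** * Construction of the limit laws *)

Section Mixture.
Context (d : measure_display) (T : measurableType d) (R : realType).
Variables (p : nat -> R) (mu : nat -> probability T R).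
Hypothesis p_ge0 : forall n, 0 <= p n.
Hypothesis p_sum1 : (\sum_(i < n) p i) @[n --> \oo] --> (1 : R).

Let mixture := mseries (fun n => mscale (NngNum (p_ge0 n)) (mu n)) 0.

Let mixtureT : mixture setT = 1%E.
Proof.
rewrite /mixture /mseries; apply/cvg_lim => //.
rewrite (_ : (fun _ => _) = EFin \o (fun n => \sum_(i < n) p i)).
  by apply/fine_cvgP; split => //; exact: nearW.
apply/funext => n /=; rewrite -sumEFin big_mkord; apply: eq_bigr => i _.
by rewrite /mscale /= probability_setT mule1.
Qed.

HB.instance Definition _ := Measure.on mixture.
HB.instance Definition _ := Measure_isProbability.Build _ _ _ mixture mixtureT.

(** Only sets charged by finitely many components are evaluated, so that no
    infinite sum is left: the limit laws below are discrete laws whose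
    distribution functions are finite sums. *)
Lemma mixture_exists : exists Q : probability T R,
  forall A N, (forall n, (N <= n)%N -> mu n A = 0%E) ->
    Q A = (\sum_(n < N) (p n)%:E * mu n A)%E.
Proof.
exists (mixture : probability T R) => A N A0.
rewrite /= /mixture /mseries (nneseries_split 0 N); last first.
  by move=> n _; rewrite /mscale /= mule_ge0 // lee_fin.
rewrite add0n big_mkord eseries0 ?adde0 // => n Nn _.
by rewrite -[LHS]/((p n)%:E * mu n A)%E A0 ?mule0.
Qed.
End Mixture.

Section Laws.
Variable R : realType.

(** The law of [1 + n], where [n] has the probability weights [p]. *)
Lemma lattice_law (p : nat -> R) :
  (forall n, 0 <= p n) -> (\sum_(i < n) p i) @[n --> \oo] --> (1 : R) ->
  exists nu : probability R R,
    [/\ forall z : R, z < 0 -> nu `]-oo, z]%classic = 0%E,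
        forall z : R, 0 <= z ->
          nu `]-oo, z]%classic = (\sum_(n < Num.truncn z) p n)%:E
      & forall n, nu [set n.+1%:R] = (p n)%:E].
Proof.
move=> p0 p1; have [nu nuE] := mixture_exists
  (fun n => dirac (n.+1%:R : R) : probability R R) p0 p1.
have diracE' n (A : set R) : \d_(n.+1%:R : R) A = ((n.+1%:R \in A)%:R)%:E :> \bar R.
  by rewrite diracE.
exists nu; split.
- move=> z z0; rewrite (nuE _ 0%N) ?big_ord0 // => n _.
  rewrite /= diracE' memNset //= in_itv /= => nz.
  by have := lt_le_trans z0 (ler0n R n.+1); rewrite ltNge nz.
- move=> z z0; rewrite (nuE _ (Num.truncn z)).
    rewrite -sumEFin; apply: eq_bigr => n _.
    rewrite /= diracE' mem_set ?mule1 //= in_itv /=.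
    by rewrite -truncn_ge_nat.
  move=> n zn; rewrite /= diracE' memNset //= in_itv /=.
  by rewrite -truncn_ge_nat // ltnNge zn.
- move=> n; rewrite (nuE _ n.+1).
    rewrite big_ord_recr big1 /= => [|i _]; last first.
      rewrite diracE' memNset ?mule0 //= => /eqP; rewrite eqr_nat eqSS => /eqP.
      by have := ltn_ord i; lia.
    by rewrite diracE' mem_set // add0e mule1.
  move=> i ni; rewrite /= diracE' memNset //= => /eqP; rewrite eqr_nat eqSS.
  by move=> /eqP; lia.
Qed.

(** The joint law of [k] with weights [a] and of [1 + l], where [l] has the
    conditional weights [b k]. *)
Lemma lattice_pair_law (a : nat -> R) (b : nat -> nat -> R) :
  (forall k, 0 <= a k) -> (\sum_(i < n) a i) @[n --> \oo] --> (1 : R) ->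
  (forall k l, 0 <= b k l) ->
  (forall k, (\sum_(i < n) b k i) @[n --> \oo] --> (1 : R)) ->
  exists nu : probability (R * R)%type R,
    [/\ forall z1 z2 : R, z1 < 0 \/ z2 < 0 ->
          nu [set w | w.1 <= z1 /\ w.2 <= z2] = 0%E,
        forall z1 z2 : R, 0 <= z1 -> 0 <= z2 ->
          nu [set w | w.1 <= z1 /\ w.2 <= z2]
          = (\sum_(k < (Num.truncn z1).+1)
               a k * \sum_(l < Num.truncn z2) b k l)%:E
      & forall k l, nu [set w | w.1 = k%:R /\ w.2 = l.+1%:R] = (a k * b k l)%:E].
Proof.
move=> a0 a1 b0 b1.
have diracE' k l (A : set (R * R)) :
    \d_((k%:R, l.+1%:R) : R * R) A = ((((k%:R, l.+1%:R) : R * R) \in A)%:R)%:E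
    :> \bar R.
  by rewrite diracE.
have /choice[mu muE] k := mixture_exists
  (fun l => dirac ((k%:R, l.+1%:R) : R * R) : probability (R * R)%type R)
  (b0 k) (b1 k).
have [nu nuE] := mixture_exists mu a0 a1.
exists nu; split.
- move=> z1 z2 z0; rewrite (nuE _ 0%N) ?big_ord0 // => k _.
  rewrite (muE _ _ 0%N) ?big_ord0 // => l _.
  rewrite /= diracE' memNset //= => -[kz lz].
  have k0 : 0 <= k%:R :> R by [].
  have l0 : 0 <= l.+1%:R :> R by [].
  by case: z0; lra.
- move=> z1 z2 z10 z20; rewrite (nuE _ (Num.truncn z1).+1).
    rewrite -sumEFin; apply: eq_bigr => k _; rewrite EFinM; congr (_ * _)%E.
    rewrite (muE _ _ (Num.truncn z2)).
      rewrite -sumEFin; apply: eq_bigr => l _.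
      rewrite /= diracE' mem_set ?mule1 //=.
      by rewrite -!truncn_ge_nat // -ltnS.
    move=> l zl; rewrite /= diracE' memNset //= => -[_].
    by rewrite -truncn_ge_nat // ltnNge zl.
  move=> k zk; rewrite (muE _ _ 0%N) ?big_ord0 // => l _.
  rewrite /= diracE' memNset //= => -[].
  by rewrite -truncn_ge_nat // leqNgt zk.
- move=> k l; rewrite (nuE _ k.+1).
    rewrite big_ord_recr big1 /= => [|i _]; last first.
      rewrite (muE _ _ 0%N) ?big_ord0 ?mule0 // => j _.
      rewrite /= diracE' memNset //= => -[] /eqP; rewrite eqr_nat => /eqP.
      by have := ltn_ord i; lia.
    rewrite (muE _ _ l.+1).
      rewrite big_ord_recr big1 /= => [|i _]; last first.
        rewrite diracE' memNset ?mule0 //= => -[_] /eqP.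
        rewrite eqr_nat eqSS => /eqP.
        by have := ltn_ord i; lia.
      by rewrite diracE' mem_set // !add0e mule1.
    move=> i li; rewrite /= diracE' memNset //= => -[_] /eqP.
    by rewrite eqr_nat eqSS => /eqP; lia.
  move=> i ki; rewrite (muE _ _ 0%N) ?big_ord0 // => j _.
  rewrite /= diracE' memNset //= => -[] /eqP; rewrite eqr_nat => /eqP; lia.
Qed.

Section CDF.
Variable F : R -> R.
Hypothesis F_nd : {homo F : x y / x <= y}.
Hypothesis F_cont : continuous F.
Hypothesis F_Ny : F x @[x --> -oo] --> (0 : R).
Hypothesis F_y : F x @[x --> +oo] --> (1 : R).

Let F_rc : right_continuous F.
Proof. by move=> x; apply: cvg_at_right_filter; exact: F_cont. Qed.

#[local] HB.instance Definition _ := isCumulative.Build R _ R F F_nd F_rc.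
#[local] HB.instance Definition _ := isCumulativeBounded.Build R 0 1 F F_Ny F_y.

(** The Lebesgue-Stieltjes measure of [F], transported to the Borel sets of the
    real line. *)
Lemma continuous_df_law : exists mu : probability R R,
  forall x, mu `]-oo, x]%classic = (F x)%:E.
Proof.
eexists; move=> x; have := cdf_lebesgue_stieltjes_id F x; rewrite /cdf; exact.
Qed.
End CDF.

End Laws.

Lemma random_variable_exists (d : measure_display) (T : measurableType d)
    (R : realType) (P : probability T R) (f : T -> R) :
  measurable_fun [set: T] f -> exists X : {RV P >-> R}, X = f :> (T -> R).
Proof. by move=> mf; exists (mfun_Sub (mem_set mf)). Qed.

Section IndependentPairs.
Variable R : realType.

Lemma coordinate_variables (P : probability (R * R)%type R) :
  exists X Y : {RV P >-> R}, X = fst :> (R * R -> R) /\ Y = snd :> (R * R -> R).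
Proof.
have [X XE] := @random_variable_exists _ _ R P (fst : R * R -> R) measurable_fst.
have [Y YE] := @random_variable_exists _ _ R P (snd : R * R -> R) measurable_snd.
by exists X, Y.
Qed.

Lemma independent_pair_of_laws (mu nu : probability R R) :
  exists (disp : measure_display) (Om : measurableType disp)
    (P : probability Om R) (X Y : {RV P >-> R}),
    [/\ independent_pair X Y,
        forall A, measurable A -> P (X @^-1` A) = mu A &
        forall A, measurable A -> P (Y @^-1` A) = nu A].
Proof.
pose P : probability (R * R)%type R := (mu \x nu)%E.
have [X [Y [XE YE]]] := coordinate_variables P.
have PX A : measurable A -> P (X @^-1` A) = mu A.
  move=> mA; rewrite XE (_ : _ @^-1` _ = A `*` setT).
    apply: etrans (product_measure1E mu nu mA measurableT) _.
    by rewrite [X in (_ * X)%E](_ : _ = 1%E) ?mule1 //; exact: probability_setT.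
  by apply/seteqP; split => x /=; tauto.
have PY A : measurable A -> P (Y @^-1` A) = nu A.
  move=> mA; rewrite YE (_ : _ @^-1` _ = setT `*` A).
    apply: etrans (product_measure1E mu nu measurableT mA) _.
    by rewrite [X in (X * _)%E](_ : _ = 1%E) ?mul1e //; exact: probability_setT.
  by apply/seteqP; split => x /=; tauto.
exists _, _, P, X, Y; split => // A B mA mB.
rewrite PX // PY // XE YE; exact: product_measure1E.
Qed.

Lemma joint_cdf_independent (disp : measure_display) (Om : measurableType disp)
    (P : probability Om R) (X Y : {RV P >-> R}) (z : R * R) :
  independent_pair X Y ->
  joint_cdf X Y z = fine (cdf X z.1) * fine (cdf Y z.2).
Proof.
move=> XY; rewrite /joint_cdf -fineM; last 2 first.
- exact: fin_num_measure.
- exact: fin_num_measure.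
by rewrite -[RHS](congr1 fine (XY _ _ _ _)).
Qed.

Lemma degenerate_pair_of_law (nu : probability R R) :
  exists (disp : measure_display) (Om : measurableType disp)
    (P : probability Om R) (X Y : {RV P >-> R}),
    [/\ independent_pair X Y, forall w, X w = 0 &
        forall A, measurable A -> P (Y @^-1` A) = nu A].
Proof.
have [Y YE] := @random_variable_exists _ _ R nu (id : R -> R) (@measurable_id _ _ setT).
have [X XE] := @random_variable_exists _ _ R nu (cst (0 : R)) (measurable_cst (0 : R)).
exists _, _, nu, X, Y; split => [A B mA mB|w|A mA]; rewrite ?XE ?YE //.
rewrite preimage_cst; case: ifPn => _.
  by rewrite setTI probability_setT mul1e.
by rewrite set0I measure0 mul0e.
Qed.

Section LinExp.
Variables lam nu : R.
Hypotheses (lam0 : 0 <= lam) (nu0 : 0 <= nu) (lam_nu : 0 < lam + nu).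

(** Replacing [x] by its positive part removes the case distinction, so that
    continuity and monotonicity become formal. The exponential and Rayleigh
    distributions are the cases [nu = 0] and [lam = 0]. *)
Lemma linexp_dfE x : linexp_df lam nu x
  = 1 - expR (- (lam * Num.max x 0 + nu * Num.max x 0 ^+ 2 / 2)).
Proof.
rewrite /linexp_df; case: ltP => x0 //.
by rewrite expr0n /= !mulr0 mul0r addr0 oppr0 expR0 subrr.
Qed.

Lemma linexp_law : exists mu : probability R R,
  forall x, mu `]-oo, x]%classic = (linexp_df lam nu x)%:E.
Proof.
apply: continuous_df_law.
- move=> x x' xx'; rewrite !linexp_dfE lerD2l lerN2 ler_expR lerN2.
  have yy : Num.max x 0 <= Num.max x' 0.
    by rewrite ge_max !le_max xx' lexx orbT.
  have y0 : 0 <= Num.max x 0 by rewrite le_max lexx orbT.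
  apply: lerD; first exact: ler_wpM2l.
  by rewrite ler_wpM2r // ler_wpM2l // lerXn2r // ?nnegrE // (le_trans y0).
- move=> x; rewrite (_ : linexp_df _ _ = fun x =>
    1 - expR (- (lam * Num.max x 0 + nu * Num.max x 0 ^+ 2 / 2))); last first.
    by apply/funext => u; rewrite linexp_dfE.
  have cy : Num.max u 0 @[u --> x] --> Num.max x 0.
    by apply: continuous_max; [exact: cvg_id|exact: cvg_cst].
  apply: cvgB; first exact: cvg_cst.
  apply: continuous_cvg; first exact: continuous_expR.
  apply: cvgN; apply: cvgD; first by apply: cvgMr.
  apply: cvgMl; apply: cvgMr.
  by rewrite !expr2; apply: cvgM.
- apply: cvg_near_cst; near=> x; rewrite linexp_dfE.
  have x0 : x <= 0 by near: x; exact: nbhs_ninfty_le.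
  by rewrite max_r // expr0n /= !mulr0 mul0r addr0 oppr0 expR0 subrr.
- rewrite -[X in _ --> X]subr0; under eq_fun do rewrite linexp_dfE.
  apply: cvgB; first exact: cvg_cst.
  apply: (@cvg_comp _ _ _ _ (fun x => expR (- x)) _ (pinfty_nbhs R));
    last exact: cvgr_expR.
  have c0 : 0 < lam + nu / 2 by move: lam0 nu0 lam_nu; lra.
  apply/cvgryPge => A; near=> x.
  have x1 : 1 <= x by near: x; apply: nbhs_pinfty_ge; rewrite num_real.
  have Ax : A / (lam + nu / 2) <= x by near: x; apply: nbhs_pinfty_ge; rewrite num_real.
  have x0 : 0 <= x by apply: le_trans x1.
  rewrite max_l //; apply: (@le_trans _ _ (x * (lam + nu / 2))).
    by rewrite -ler_pdivrMr.
  have : 0 <= nu * (x * (x - 1)) by rewrite mulr_ge0 // mulr_ge0 // subr_ge0.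
  have := mulr_ge0 lam0 x0; rewrite expr2; lra.
Unshelve. all: by end_near. Qed.
End LinExp.

Section Beta.
Variable m : nat.
Hypothesis m0 : (0 < m)%N.

Lemma beta1_dfE y : beta1_df m y = 1 - Num.max (1 - Num.max y 0) 0 ^+ m :> R.
Proof.
rewrite /beta1_df; have [y0|y0] := leP y 0.
  by rewrite subr0 max_l // expr1n subrr.
have [y1|y1] := ltP y 1; first by rewrite max_l // subr_ge0 ltW.
by rewrite max_r ?subr_le0 // expr0n eqn0Ngt m0 subr0.
Qed.

Lemma beta1_law : exists mu : probability R R,
  forall x, mu `]-oo, x]%classic = (beta1_df m x)%:E.
Proof.
apply: continuous_df_law.
- move=> x x' xx'; rewrite !beta1_dfE lerD2l lerN2.
  have le_max0 (u v : R) : u <= v -> Num.max u 0 <= Num.max v 0.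
    by move=> uv; rewrite ge_max !le_max uv lexx orbT.
  have max0 (u : R) : 0 <= Num.max u 0 by rewrite le_max lexx orbT.
  apply: lerXn2r; rewrite ?nnegrE ?max0 //.
  by apply: (le_max0 _ _); rewrite lerD2l lerN2; exact: le_max0.
- move=> x; rewrite (_ : beta1_df m = fun y =>
    1 - Num.max (1 - Num.max y 0) 0 ^+ m :> R); last first.
    by apply/funext => u; rewrite beta1_dfE.
  have cmax : Num.max (1 - Num.max u 0) 0 @[u --> x]
      --> Num.max (1 - Num.max x 0) 0.
    apply: (@continuous_max R R (fun u => 1 - Num.max u 0) (cst 0) x);
      last exact: cvg_cst.
    apply: cvgB; first exact: cvg_cst.
    by apply: continuous_max; [exact: cvg_id|exact: cvg_cst].
  apply: cvgB; first exact: cvg_cst.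
  apply: (@continuous_cvg _ _ _ _ _ _ (fun u : R => u ^+ m)) cmax.
  exact: exprn_continuous.
- apply: cvg_near_cst; near=> x.
  have x0 : x <= 0 by near: x; apply: nbhs_ninfty_le; rewrite num_real.
  by rewrite /beta1_df x0.
- apply: cvg_near_cst; near=> x.
  have x1 : 1 <= x by near: x; apply: nbhs_pinfty_ge; rewrite num_real.
  by rewrite /beta1_df leNgt (lt_le_trans ltr01 x1) ltNge x1.
Unshelve. all: by end_near. Qed.
End Beta.
End IndependentPairs.

Section Uniform.
Variable R : realType.

Lemma uniform_prob_gt (y : R) : y < 1 ->
  uniform_prob (@ltr01 R) `]y, +oo[%classic = (1 - Num.max y 0)%:E.
Proof.
move=> y1; rewrite /uniform_prob integral_uniform_pdf.
pose D : set R := if y < 0 then `[0, 1]%classic else `]y, 1]%classic.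
have -> : `]y, +oo[%classic `&` `[0, 1]%classic = D.
  rewrite /D; apply/seteqP; split => x; case: ifPn => y0 /=;
    rewrite !in_itv /= ?andbT.
  - by case.
  - by case=> -> /andP[].
  - by move=> /andP[x0 x1]; rewrite x0 x1 (lt_le_trans y0).
  - move=> /andP[yx x1]; rewrite yx x1 andbT; split => //.
    by rewrite (le_trans _ (ltW yx)) // leNgt.
rewrite (eq_integral (fun=> 1%:E)); last first.
  move=> x; rewrite inE /D /uniform_pdf subr0 invr1; case: ifPn => y0 /=.
    by rewrite in_itv /= => ->.
  rewrite in_itv /= => /andP[yx ->]; rewrite andbT (le_trans _ (ltW yx)) //.
  by rewrite leNgt.
rewrite integral_cst ?mul1e; last by rewrite /D; case: ifP.
rewrite /D; case: ltP => y0.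
  apply: etrans (lebesgue_measure_itv `[0, 1]) _.
  by rewrite /= lte_fin ltr01.
apply: etrans (lebesgue_measure_itv `]y, 1]) _.
by rewrite /= lte_fin y1.
Qed.

(** The minimum exceeds [y] when all the variables do, and the product rule
    gives [(1 - y) ^ k]. *)
Lemma min_uniform_df k (disp : measure_display) (Om : measurableType disp)
    (P : probability Om R) (U : 'I_k -> {RV P >-> R}) (y : R) :
  (0 < k)%N -> independent_family U ->
  (forall i (A : set R), measurable A ->
     distribution P (U i) A = uniform_prob (@ltr01 R) A) ->
  P [set w | \big[Num.min/1]_(i < k) U i w <= y] = (beta1_df k y)%:E.
Proof.
move=> k0 indU unifU; rewrite beta1_dfE //.
have [y1|y1] := leP 1 y.
  rewrite (_ : [set w | _] = setT); last first.
    by apply/seteqP; split => w //= _; exact: le_trans (bigmin_le_id _ _ _ _) y1.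
  rewrite probability_setT max_r ?expr0n ?eqn0Ngt ?k0 ?subr0 //.
  by rewrite subr_le0 le_max y1.
pose A := \bigcap_(i in [set: 'I_k]) (U i @^-1` `]y, +oo[%classic).
have mA : measurable A.
  apply: fin_bigcap_measurable => [|i _]; first exact: finite_finset.
  exact: measurable_funPTI.
rewrite (_ : [set w | _] = ~` A); last first.
  rewrite -[LHS]setCK; congr (~` _); apply/seteqP; split => w /=.
    move=> /negP; rewrite -ltNge => /bigmin_gtP[_ yU] i _ /=.
    by rewrite in_itv /= andbT; exact: yU.
  move=> Aw; apply/negP; rewrite -ltNge; apply/bigmin_gtP; split => // i _.
  by have := Aw i I; rewrite /= in_itv /= andbT.
rewrite probability_setC // /A indU //.
under eq_bigr do rewrite -[P _]/(distribution P _ _) unifU // uniform_prob_gt //.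
rewrite prodEFin prodr_const card_ord [Num.max (1 - _) _]max_l //.
by rewrite subr_ge0 ge_max ler01 andbT ltW.
Qed.

Lemma sum_geometric (r : R) n : \sum_(i < n) (1 - r) * r ^+ i = 1 - r ^+ n.
Proof.
elim: n => [|n IH]; first by rewrite big_ord0 expr0 subrr.
by rewrite big_ord_recr /= IH exprS; ring.
Qed.

Lemma cvg_sum_geometric (r : R) : 0 <= r -> r < 1 ->
  (\sum_(i < n) (1 - r) * r ^+ i) @[n --> \oo] --> (1 : R).
Proof.
move=> r0 r1; rewrite -[X in _ --> X]subr0.
under eq_fun do rewrite sum_geometric.
apply: cvgB; first exact: cvg_cst.
by apply: cvg_expr; rewrite ger0_norm.
Qed.

Lemma geometric_half_law : exists nu : probability R R,
    [/\ forall z : R, z < 0 -> nu `]-oo, z]%classic = 0%E,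
        forall z : R, 0 <= z ->
          nu `]-oo, z]%classic = (1 - (1 / 2) ^+ Num.truncn z)%:E
      & forall l, (1 <= l)%N -> nu [set l%:R] = ((1 / 2) * (1 - 1 / 2) ^+ l.-1)%:E].
Proof.
have half : 1 - 1 / 2 = 1 / 2 :> R by field.
have h0 : 0 <= 1 / 2 :> R by rewrite divr_ge0.
have h1 : 1 / 2 < 1 :> R by lra.
have p0 n : 0 <= (1 - 1 / 2) * (1 / 2) ^+ n :> R.
  by rewrite mulr_ge0 ?exprn_ge0 // half.
have [nu [nuN nuP nu1]] := lattice_law p0 (cvg_sum_geometric h0 h1).
exists nu; split => [//|z z0|[//|l] _].
  by rewrite nuP // sum_geometric.
by rewrite nu1 half.
Qed.
End Uniform.

(** * From tails to convergence in distribution *)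

Section Thresholds.
Variable R : realType.

(** Turns a bound on a scaled count into a strict bound on the count itself;
    the successor keeps it positive, as the tail formulas require. *)
Definition cutoff (s z : R) : nat := (Num.truncn (z / s)).+1.

Lemma scaled_le_cutoff (s z : R) n : 0 < s -> 0 <= z ->
  (s * n%:R <= z) = (n < cutoff s z)%N.
Proof.
move=> s0 z0; rewrite ltnS truncn_ge_nat; last by rewrite divr_ge0 // ltW.
by rewrite ler_pdivlMr // mulrC.
Qed.

Lemma cvg_cutoff (s : nat -> R) (z : R) : 0 <= z ->
  (\forall m \near \oo, 0 < s m) -> s m @[m --> \oo] --> (0 : R) ->
  (cutoff (s m) z)%:R * s m @[m --> \oo] --> z.
Proof.
move=> z0 s0 cs.
apply: (@squeeze_cvgr _ _ _ _ (fun=> z) (fun m => z + s m)).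
- near=> m.
  have sm0 : 0 < s m by near: m.
  have /andP[lo hi] := truncn_itv (divr_ge0 z0 (ltW sm0)).
  rewrite /cutoff; apply/andP; split.
    by rewrite -ler_pdivrMr // ltW.
  by rewrite -natr1 mulrDl mul1r lerD2r -ler_pdivlMr.
- exact: cvg_cst.
- by rewrite -[X in _ --> X]addr0; apply: cvgD => //; exact: cvg_cst.
Unshelve. all: by end_near. Qed.

(** Both coordinates are non-negative, and at non-negative arguments their
    distribution function is an exact expression in the cutoffs, so that
    convergence becomes a statement about [below_prob]. *)
Lemma cvg_in_distribution_below (disp : measure_display)
    (Om : measurableType disp) (P : probability Om R) (X Y : {RV P >-> R})
    (m2 : nat -> nat) (tie : nat -> seq colour -> colour) (s t : nat -> R)
    (Z : nat -> seq colour -> R * R) :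
  (\forall m \near \oo, (0 < m2 m <= m)%N) ->
  (\forall m \near \oo, 0 < s m) -> (\forall m \near \oo, 0 < t m) ->
  (forall m w, Z m w = (s m * (nonzero_ties w)%:R,
                        t m * (sure_guesses (tie m) w)%:R)) ->
  (forall z1 z2, z1 < 0 \/ z2 < 0 -> joint_cdf X Y (z1, z2) = 0) ->
  (forall z1 z2, 0 <= z1 -> 0 <= z2 ->
     below_prob R m (m2 m) (cutoff (s m) z1) (cutoff (t m) z2) @[m --> \oo]
       --> joint_cdf X Y (z1, z2)) ->
  cvg_in_distribution m2 Z X Y.
Proof.
move=> m20 s0 t0 ZE neg pos [z1 z2] _ /=.
have [z1N|z10] := ltP z1 0.
  rewrite neg; last by left.
  apply: (@cvg_near_eq _ _ (fun=> 0)); last exact: cvg_cst.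
  near=> m; rewrite /deck_prob (_ : finset _ = finset.set0) ?cards0 ?mul0r //.
  apply/setP => w; rewrite !inE ZE /=.
  apply/negbTE; rewrite !negb_and -!ltNge (lt_le_trans z1N) ?orbT //.
  by rewrite mulr_ge0 // ltW //; near: m.
have [z2N|z20] := ltP z2 0.
  rewrite neg; last by right.
  apply: (@cvg_near_eq _ _ (fun=> 0)); last exact: cvg_cst.
  near=> m; rewrite /deck_prob (_ : finset _ = finset.set0) ?cards0 ?mul0r //.
  apply/setP => w; rewrite !inE ZE /=.
  apply/negbTE; rewrite !negb_and -!ltNge (lt_le_trans z2N) ?orbT //.
  by rewrite mulr_ge0 // ltW //; near: m.
apply: cvg_near_eq (pos _ _ z10 z20); near=> m.
rewrite -deck_prob_below //; last by near: m.
rewrite /deck_prob; congr (_%:R / _); apply: eq_card => w; rewrite !inE ZE /=.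
rewrite sure_guessesE !scaled_le_cutoff //; near: m; [exact: t0|exact: s0].
Unshelve. all: by end_near. Qed.

(** A common form of the three near-balanced regimes, with ties measured on a
    scale [s] tending to 0. The constants [al] and [be] are the limits of the
    drift and of the diffusive part of the tie exponent per unit of scaled
    time; one of them may vanish. *)
Lemma central_regime (m2 : nat -> nat) (tie : nat -> seq colour -> colour)
    (s : nat -> R) (al be : R) (Z : nat -> seq colour -> R * R) :
  0 <= al -> 0 <= be -> 0 < al + be ->
  (\forall m \near \oo, (m2 m <= m)%N) ->
  (m2 m)%:R / m%:R @[m --> \oo] --> (1 : R) ->
  (\forall m \near \oo, 0 < s m) -> s m @[m --> \oo] --> (0 : R) ->
  (m%:R - (m2 m)%:R) / (m%:R * s m) @[m --> \oo] --> al ->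
  (m%:R * s m ^+ 2)^-1 @[m --> \oo] --> be ->
  (forall m w, Z m w = (s m * (nonzero_ties w)%:R,
                        (sure_guesses (tie m) w)%:R)) ->
  exists (disp : measure_display) (Om : measurableType disp)
    (P : probability Om R) (X Y : {RV P >-> R}),
    [/\ independent_pair X Y, has_df X (linexp_df (al / 2) (be / 2)),
        geometric_law Y (1 / 2) & cvg_in_distribution m2 Z X Y].
Proof.
move=> al0 be0 ab0 m2m m21 s0 cs cal cbe ZE.
have [mu muE] := @linexp_law R (al / 2) (be / 2)
  (divr_ge0 al0 (ler0n _ _)) (divr_ge0 be0 (ler0n _ _)) ltac:(lra).
have [nu [nuN nuP nu1]] := geometric_half_law R.
have [disp [Om [P [X [Y [XY PX PY]]]]]] := independent_pair_of_laws mu nu.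
exists disp, Om, P, X, Y; split => //.
- by move=> x; rewrite -muE -PX.
- by move=> l l1; rewrite /pmf PY // nu1.
have cdfX z : cdf X z = (linexp_df (al / 2) (be / 2) z)%:E.
  by rewrite -muE -PX.
have cdfY z : cdf Y z = nu `]-oo, z]%classic by rewrite -PY.
have m2pos : \forall m \near \oo, (0 < m2 m <= m)%N.
  near=> m; apply/andP; split; last by near: m.
  have : 0 < (m2 m)%:R / m%:R :> R.
    by near: m; apply: (cvgr_gt _ m21); exact: ltr01.
  by rewrite lt0n; apply: contraTneq => ->; rewrite mul0r ltxx.
apply: (@cvg_in_distribution_below _ _ _ _ _ _ tie s (fun=> 1)) => //.
- exact: nearW.
- by move=> m w; rewrite mul1r.
- move=> z1 z2 z0; rewrite joint_cdf_independent // cdfX cdfY /=.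
  have [z2N|z20] := ltP z2 0; first by rewrite nuN // mulr0.
  case: z0 => [z1N|]; last by rewrite ltNge z20.
  by rewrite /linexp_df ltNge (ltW z1N) /= mul0r.
move=> z1 z2 z10 z20; rewrite joint_cdf_independent // cdfX cdfY /= nuP //=.
rewrite linexp_dfE max_l // /cutoff divr1; set l := Num.truncn z2.
pose k m := cutoff (s m) z1.
have ck : (k m)%:R * s m @[m --> \oo] --> z1 by exact: cvg_cutoff.
have s00 : \forall m \near \oo, s m != 0 /\ m%:R != 0 :> R.
  near=> m; split; first by rewrite gt_eqF //; near: m.
  by rewrite pnatr_eq0 -lt0n; near: m; exact: near_gt0.
have k0 : (k m)%:R / m%:R @[m --> \oo] --> (0 : R).
  apply: (@cvg_near_eq _ _ (fun m => (k m)%:R * s m * (s m * (m%:R * s m ^+ 2)^-1))).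
    near=> m; have [sm0 m0] : s m != 0 /\ m%:R != 0 :> R by near: m.
    by field; rewrite sm0 m0.
  rewrite -(mulr0 z1); apply: cvgM => //; rewrite -(mul0r be); exact: cvgM.
have kal : (k m)%:R * (m%:R - (m2 m)%:R) / m%:R @[m --> \oo] --> z1 * al.
  apply: (@cvg_near_eq _ _ (fun m => (k m)%:R * s m *
      ((m%:R - (m2 m)%:R) / (m%:R * s m)))); last exact: cvgM.
  near=> m; have [sm0 m0] : s m != 0 /\ m%:R != 0 :> R by near: m.
  by field; rewrite sm0 m0.
have kbe : (k m)%:R ^+ 2 / m%:R @[m --> \oo] --> z1 ^+ 2 * be.
  apply: (@cvg_near_eq _ _ (fun m => (k m)%:R * s m * ((k m)%:R * s m) *
      (m%:R * s m ^+ 2)^-1)).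
    near=> m; have [sm0 m0] : s m != 0 /\ m%:R != 0 :> R by near: m.
    by field; rewrite sm0 m0.
  by rewrite expr2; apply: cvgM => //; exact: cvgM.
have tieC := cvg_tie_tail m2m m21 k0 kal kbe.
have tie_runC := @cvg_black_end_add _ _ k l 1 ler01 m21 k0 _ tieC.
have blackC := @cvg_black_end _ _ l.+1 1 ler01 m21.
have m2gt0 : \forall m \near \oo, (0 < m2 m)%N.
  by near=> m; have /andP[] : (0 < m2 m <= m)%N by near: m.
have redC := @cvg_red_end _ _ l.+1 1 ler01 m2gt0 m21.
have -> : al / 2 * z1 + be / 2 * z1 ^+ 2 / 2 = z1 * al / 2 + z1 ^+ 2 * be / 4.
  by field.
set E := expR _ in tieC tie_runC *.
have halfE : 1 / (1 + 1) = 1 / 2 :> R by [].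
rewrite halfE in tie_runC blackC redC.
rewrite (_ : (1 - E) * _ = 1 - E - ((1 / 2) ^+ l.+1 + (1 / 2) ^+ l.+1)
   + E * (1 / 2) ^+ l); last by rewrite exprS; field.
apply: cvgD; last first.
  rewrite (_ : (fun m => _) =
    fun m => 2 ^+ k m * black_end R m (m2 m) (k m + l)) //.
  by apply/funext => m; rewrite addnS subn1.
apply: cvgB; last exact: cvgD.
by apply: cvgB => //; exact: cvg_cst.
Unshelve. all: by end_near. Qed.

End Thresholds.

(** * The growth regimes *)

Section Landau.
Variable R : realType.

Lemma littleo_ratio (f g : nat -> R) : (\forall m \near \oo, g m != 0) ->
  f =o_\oo g -> f m / g m @[m --> \oo] --> (0 : R).
Proof.
move=> g0 /eqoP fg; apply/cvgr0Pnorm_le => e e0.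
near=> m; rewrite normf_div ler_pdivrMr; last by rewrite normr_gt0; near: m.
by near: m; exact: fg.
Unshelve. all: by end_near. Qed.

Lemma equiv_ratio (f g : nat -> R) : (\forall m \near \oo, g m != 0) ->
  f ~_\oo g -> f m / g m @[m --> \oo] --> (1 : R).
Proof.
move=> g0 /eqaddoP fg.
have /(littleo_ratio g0) fg0 : (f - g) =o_\oo g by apply/eqoP.
apply: (@cvg_near_eq _ _ (fun m => (f - g) m / g m + 1)).
  near=> m; rewrite -[1](@divff _ (g m)); last by near: m.
  by rewrite -mulrDl /= subrK.
by rewrite -[X in _ --> X]add0r; apply: cvgD => //; exact: cvg_cst.
Unshelve. all: by end_near. Qed.
End Landau.

Section RareTies.
Variable R : realType.

Lemma cvg_black_end_small (m2 j : nat -> nat) (c : R) : 0 <= c ->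
  (m2 m)%:R / m%:R @[m --> \oo] --> (0 : R) -> (forall m, 0 < j m)%N ->
  c * black_end R m (m2 m) (j m) @[m --> \oo] --> (0 : R).
Proof.
move=> c0 m20 j0.
apply: (@squeeze_cvgr _ _ _ _ (fun=> 0) (fun m => c * ((m2 m)%:R / m%:R))).
- near=> m; have m0 : (0 < m)%N by near: m; exact: near_gt0.
  rewrite mulr_ge0 ?black_end_ge0 //= ler_wpM2l //.
  apply: le_trans (black_end_le _ _ m0 (j0 m)) _.
  by rewrite ler_wpM2l // lef_pV2 ?posrE ?ltr0n ?ler_nat ?leq_addr // addn_gt0 m0.
- exact: cvg_cst.
- by rewrite -(mulr0 c); apply: cvgMr.
Unshelve. all: by end_near. Qed.

(** A tie occurs with twice the probability that the last card is black, and
    this probability tends to 0 with the proportion of black cards: the only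
    tail that survives is that of a red bottom block. *)
Lemma rare_tie_regime (m2 : nat -> nat) (tie : nat -> seq colour -> colour)
    (t : nat -> R) (nu : probability R R) (G : R -> R)
    (Z : nat -> seq colour -> R * R) :
  (\forall m \near \oo, (0 < m2 m <= m)%N) ->
  (m2 m)%:R / m%:R @[m --> \oo] --> (0 : R) ->
  (\forall m \near \oo, 0 < t m) ->
  (forall x, nu `]-oo, x]%classic = (G x)%:E) ->
  (forall x, x < 0 -> G x = 0) ->
  (forall x, 0 <= x ->
     black_end R (m2 m) m (cutoff (t m) x) @[m --> \oo] --> 1 - G x) ->
  (forall m w, Z m w = ((nonzero_ties w)%:R,
                        t m * (sure_guesses (tie m) w)%:R)) ->
  exists (disp : measure_display) (Om : measurableType disp)
    (P : probability Om R) (X Y : {RV P >-> R}),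
    [/\ independent_pair X Y, forall w : Om, X w = 0, has_df Y G
      & cvg_in_distribution m2 Z X Y].
Proof.
move=> m2m m20 t0 nuG GN redC ZE.
have [disp [Om [P [X [Y [XY X0 PY]]]]]] := degenerate_pair_of_law nu.
have cdfY z : cdf Y z = (G z)%:E by rewrite -nuG -PY.
exists disp, Om, P, X, Y; split => //.
have cdfX z : cdf X z = (if 0 <= z then 1 else 0 : R)%:E.
  rewrite /cdf /distribution /pushforward; case: leP => z0.
    rewrite (_ : _ @^-1` _ = setT) ?probability_setT //.
    by apply/seteqP; split => w //= _; rewrite X0 in_itv.
  rewrite (_ : _ @^-1` _ = set0) ?measure0 //.
  by apply/seteqP; split => w //=; rewrite X0 in_itv /= leNgt z0.
apply: (@cvg_in_distribution_below _ _ _ _ _ _ _ tie (fun=> 1) t) => //.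
- exact: nearW.
- by move=> m w; rewrite mul1r.
- move=> z1 z2 z0; rewrite joint_cdf_independent // cdfX cdfY /=.
  by case: z0 => z0; [rewrite leNgt z0 mul0r|rewrite GN // mulr0].
move=> z1 z2 z10 z20; rewrite joint_cdf_independent // cdfX cdfY /= z10 mul1r.
have -> : G z2 = 1 - 0 - (0 + (1 - G z2)) + 0 by ring.
have c0 : 0 <= 2 ^+ cutoff 1 z1 :> R by rewrite exprn_ge0.
apply: cvgD; last by apply: cvg_black_end_small => // m; rewrite addnS subn1.
apply: cvgB.
  by apply: cvgB; [exact: cvg_cst|exact: cvg_black_end_small].
apply: cvgD; last exact: redC.
under eq_fun do rewrite -[black_end _ _ _ _]mul1r.
exact: cvg_black_end_small.
Qed.

(** All tails converge without scaling. With [q = rho / (1 + rho)] and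
    [p = 1 - q], the limit of the number of ties is geometric with weights
    [(1 - 2 q) (2 q) ^ k]. Given at least one tie, the bottom block is geometric
    with weights [p q ^ l], starting at [l = 0] for a block of one card; without
    a tie its weights are [(p ^ l.+1 q - q ^ l.+1 p) / (1 - 2 q)]. *)
Lemma proportional_regime (m2 : nat -> nat) (tie : nat -> seq colour -> colour)
    (rho : R) (Z : nat -> seq colour -> R * R) :
  0 < rho -> rho < 1 ->
  (\forall m \near \oo, (m2 m <= m)%N) ->
  (m2 m)%:R / m%:R @[m --> \oo] --> rho ->
  (forall m w, Z m w = ((nonzero_ties w)%:R, (sure_guesses (tie m) w)%:R)) ->
  exists (disp : measure_display) (Om : measurableType disp)
    (P : probability Om R) (X Y : {RV P >-> R}),
    (forall k l : nat, (1 <= l)%N ->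
       joint_pmf X Y k%:R l%:R = limit_pmf rho k l) /\
    cvg_in_distribution m2 Z X Y.
Proof.
move=> rho0 rho1 m2m m2rho ZE.
pose q := rho / (1 + rho); pose p := 1 / (1 + rho).
have d0 : 0 < 1 + rho by lra.
have pE : p = 1 - q by rewrite /p /q; field; lra.
have q0 : 0 < q by rewrite divr_gt0.
have q1 : 2 * q < 1 by rewrite /q mulrA ltr_pdivrMr //; lra.
have p1 : p < 1 by lra.
have p0 : 0 < p by rewrite divr_gt0.
pose a k := (1 - 2 * q) * (2 * q) ^+ k.
pose b k l := if k == 0%N then (p ^+ l.+1 * q - q ^+ l.+1 * p) / (1 - 2 * q)
  else (1 - q) * q ^+ l.
have bsum k n : \sum_(l < n) b k l =
    if k == 0%N then (p * (1 - p ^+ n) - q * (1 - q ^+ n)) / (1 - 2 * q)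
    else 1 - q ^+ n.
  rewrite /b; case: eqP => _; last exact: sum_geometric.
  rewrite -mulr_suml; congr (_ / _); rewrite -!sum_geometric !mulr_sumr -sumrB.
  by apply: eq_bigr => l _; rewrite !exprS pE; ring.
have a0 k : 0 <= a k by rewrite mulr_ge0 ?exprn_ge0 //; lra.
have b0 k l : 0 <= b k l.
  rewrite /b; case: eqP => _; last by rewrite mulr_ge0 ?exprn_ge0 //; lra.
  rewrite divr_ge0 //; last by lra.
  have -> : p ^+ l.+1 * q - q ^+ l.+1 * p = p * q * (p ^+ l - q ^+ l).
    by rewrite !exprS; ring.
  rewrite mulr_ge0 ?subr_ge0 ?lerXn2r ?nnegrE //; try lra.
  by rewrite mulr_ge0 //; lra.
have asum : (\sum_(k < n) a k) @[n --> \oo] --> (1 : R).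
  by apply: cvg_sum_geometric; lra.
have pow0 (x : R) : 0 < x -> x < 1 -> x ^+ n @[n --> \oo] --> (0 : R).
  by move=> x0 x1; apply: cvg_expr; rewrite gtr0_norm.
have bsum1 k : (\sum_(l < n) b k l) @[n --> \oo] --> (1 : R).
  rewrite (_ : (fun n => _) = fun n =>
    if k == 0%N then (p * (1 - p ^+ n) - q * (1 - q ^+ n)) / (1 - 2 * q)
    else 1 - q ^+ n); last by apply/funext => n; exact: bsum.
  have pown (x : R) : 0 < x -> x < 1 -> 1 - x ^+ n @[n --> \oo] --> (1 : R).
    move=> x0 x1; rewrite -[X in _ --> X]subr0.
    by apply: cvgB; [exact: cvg_cst|exact: pow0].
  case: eqP => _; last by apply: pown; lra.
  rewrite [X in _ --> X](_ : (1 : R) = (p * 1 - q * 1) / (1 - 2 * q)); last first.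
    by rewrite pE; field; lra.
  apply: cvgMl; apply: cvgB; apply: cvgMr; apply: pown; lra.
have [nu [nuN nuP nu1]] := lattice_pair_law a0 asum b0 bsum1.
have [X [Y [XE YE]]] := coordinate_variables nu.
exists _, _, nu, X, Y; split.
  move=> k [//|l] _; rewrite /joint_pmf XE YE nu1 /= /limit_pmf /a /b.
  case: eqP => [->|_].
    rewrite expr0 mulr1 mulrC mulfVK; last by rewrite subr_eq0 gt_eqF.
    rewrite /p /q !expr_div_n expr1n [(1 + rho) ^+ l.+2]exprS.
    have d1 : 1 + rho != 0 by rewrite gt_eqF.
    by field; rewrite expf_neq0.
  rewrite -/q exprS -[_ / (1 + rho)]mulrA.
  have -> : 1 - q = (1 - rho) / (rho * (1 + rho)) * q / (1 - 2 * q).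
    rewrite /q; field; lra.
  by field; lra.
have m2pos : \forall m \near \oo, (0 < m2 m <= m)%N.
  near=> m; apply/andP; split; last by near: m.
  have : 0 < (m2 m)%:R / m%:R :> R by near: m; apply: (cvgr_gt _ m2rho).
  by rewrite lt0n; apply: contraTneq => ->; rewrite mul0r ltxx.
have m2gt0 : \forall m \near \oo, (0 < m2 m)%N.
  by near=> m; have /andP[] : (0 < m2 m <= m)%N by near: m.
apply: (@cvg_in_distribution_below _ _ _ _ _ _ _ tie (fun=> 1) (fun=> 1)) => //.
- exact: nearW.
- exact: nearW.
- by move=> m w; rewrite !mul1r.
- by move=> z1 z2 z0; rewrite /joint_cdf XE YE nuN.
move=> z1 z2 z10 z20; rewrite /joint_cdf XE YE nuP //= /cutoff !divr1.
set k := Num.truncn z1; set l := Num.truncn z2.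
rewrite big_ord_recl bsum /= (eq_bigr (fun i : 'I_k =>
  2 * q * (1 - q ^+ l) * ((1 - 2 * q) * (2 * q) ^+ i))); last first.
  by move=> i _; rewrite bsum /= /a /bump /= add1n exprS; ring.
rewrite -mulr_sumr sum_geometric /a expr0 mulr1.
rewrite [(1 - 2 * q) * _]mulrC mulfVK; last by rewrite subr_eq0 gt_eqF.
have -> : p * (1 - p ^+ l) - q * (1 - q ^+ l)
      + 2 * q * (1 - q ^+ l) * (1 - (2 * q) ^+ k)
    = 1 - 2 ^+ k.+1 * q ^+ k.+1 - (q ^+ l.+1 + p ^+ l.+1)
      + 2 ^+ k.+1 * q ^+ (k.+1 + l.+1 - 1).
  rewrite addnS subn1 /= addSn !exprS exprD [(2 * q) ^+ k]exprMn pE; ring.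
have rho0' := ltW rho0.
have blackC j := @cvg_black_end R m2 j rho rho0' m2rho.
apply: cvgD; last by apply: cvgMr; exact: blackC.
apply: cvgB.
  by apply: cvgB; [exact: cvg_cst|apply: cvgMr; exact: blackC].
by apply: cvgD; [exact: blackC|exact: cvg_red_end].
Unshelve. all: by end_near. Qed.

End RareTies.

Section Scalings.
Variable R : realType.

Lemma cvg_inv_sqrtn : (Num.sqrt m%:R)^-1 @[m --> \oo] --> (0 : R).
Proof.
rewrite -(sqrtr0 R); under eq_fun do rewrite -sqrtrV //.
by apply: continuous_cvg; [exact: sqrt_continuous|exact: cvg_invn].
Qed.

(** On the scale [sqrt m] the diffusive part has limit 1, while [al] may be 0;
    this gives the linear exponential law and, for [al = 0], the Rayleigh
    law. *)
Lemma critical_regime (m2 : nat -> nat) (tie : nat -> seq colour -> colour)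
    (al : R) (Z : nat -> seq colour -> R * R) :
  0 <= al ->
  (\forall m \near \oo, (m2 m <= m)%N) ->
  (m2 m)%:R / m%:R @[m --> \oo] --> (1 : R) ->
  (m%:R - (m2 m)%:R) / Num.sqrt m%:R @[m --> \oo] --> al ->
  (forall m w, Z m w = ((nonzero_ties w)%:R / Num.sqrt m%:R,
                        (sure_guesses (tie m) w)%:R)) ->
  exists (disp : measure_display) (Om : measurableType disp)
    (P : probability Om R) (X Y : {RV P >-> R}),
    [/\ independent_pair X Y, has_df X (linexp_df (al / 2) (1 / 2)),
        geometric_law Y (1 / 2) & cvg_in_distribution m2 Z X Y].
Proof.
move=> al0 m2m m21 Dal ZE.
have sq (m : nat) : (0 < m)%N -> 0 < Num.sqrt m%:R :> R.
  by move=> m0; rewrite sqrtr_gt0 ltr0n.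
apply: (@central_regime R m2 tie (fun m => (Num.sqrt m%:R)^-1)) => //.
- by rewrite ltr_wpDl.
- by near=> m; rewrite invr_gt0 sq //; near: m; exact: near_gt0.
- exact: cvg_inv_sqrtn.
- apply: cvg_near_eq Dal; near=> m; congr (_ / _).
  have m0 : (0 < m)%N by near: m; exact: near_gt0.
  by rewrite -[X in X / _]sqr_sqrtr // expr2 mulfK // gt_eqF // sq.
- apply: (@cvg_near_eq _ _ (fun=> 1)); last exact: cvg_cst.
  near=> m; have m0 : (0 < m)%N by near: m; exact: near_gt0.
  by rewrite exprVn sqr_sqrtr // divff ?invr1 // pnatr_eq0 -lt0n.
- by move=> m w; rewrite ZE mulrC.
Unshelve. all: by end_near. Qed.

(** On the scale [m / D m] the drift has limit 1, and the diffusive part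
    [m / (D m) ^ 2] vanishes. *)
Lemma subcritical_regime (m2 : nat -> nat) (tie : nat -> seq colour -> colour)
    (Z : nat -> seq colour -> R * R) :
  let D (m : nat) : R := m%:R - (m2 m)%:R in
  (\forall m \near \oo, (m2 m <= m)%N) ->
  (m2 m)%:R / m%:R @[m --> \oo] --> (1 : R) ->
  (\forall m \near \oo, D m != 0) ->
  Num.sqrt m%:R / D m @[m --> \oo] --> (0 : R) ->
  D m / m%:R @[m --> \oo] --> (0 : R) ->
  (forall m w, Z m w = (D m * (nonzero_ties w)%:R / m%:R,
                        (sure_guesses (tie m) w)%:R)) ->
  exists (disp : measure_display) (Om : measurableType disp)
    (P : probability Om R) (X Y : {RV P >-> R}),
    [/\ independent_pair X Y, has_df X (exp_df (1 / 2)),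
        geometric_law Y (1 / 2) & cvg_in_distribution m2 Z X Y].
Proof.
move=> D m2m m21 D0 sqD Dm ZE.
have -> : exp_df (1 / 2) = linexp_df (1 / 2) (0 / 2) :> (R -> R).
  by apply/funext => x; rewrite /exp_df /linexp_df !mul0r addr0.
apply: (@central_regime R m2 tie (fun m => D m / m%:R)) => //.
- near=> m; rewrite divr_gt0 // ?ltr0n; last by near: m; exact: near_gt0.
  by rewrite lt0r subr_ge0 ler_nat; apply/andP; split; near: m.
- apply: (@cvg_near_eq _ _ (fun=> 1)); last exact: cvg_cst.
  near=> m; have m0 : (0 < m)%N by near: m; exact: near_gt0.
  rewrite -/(D m) [m%:R * _]mulrC mulfVK; last by rewrite pnatr_eq0 -lt0n.
  by rewrite divff //; near: m.
- apply: (@cvg_near_eq _ _ (fun m => (Num.sqrt m%:R / D m) ^+ 2)).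
    near=> m; have m0 : m%:R != 0 :> R.
      by rewrite pnatr_eq0 -lt0n; near: m; exact: near_gt0.
    have Dm0 : D m != 0 by near: m.
    by rewrite [(Num.sqrt _ / _) ^+ 2]expr_div_n sqr_sqrtr //; field; rewrite m0 Dm0.
  by rewrite -(mulr0 (0 : R)); under eq_fun do rewrite expr2; exact: cvgM.
- by move=> m w; rewrite ZE mulrAC.
Unshelve. all: by end_near. Qed.

Lemma sparse_regime (m2 : nat -> nat) (tie : nat -> seq colour -> colour)
    (Z : nat -> seq colour -> R * R) :
  (\forall m \near \oo, (m2 m <= m)%N) ->
  (m2 m)%:R / m%:R @[m --> \oo] --> (0 : R) ->
  m2 @ \oo --> \oo ->
  (forall m w, Z m w = ((nonzero_ties w)%:R,
     (m2 m)%:R * (sure_guesses (tie m) w)%:R / m%:R)) ->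
  exists (disp : measure_display) (Om : measurableType disp)
    (P : probability Om R) (X Y : {RV P >-> R}),
    [/\ independent_pair X Y, forall w : Om, X w = 0, has_df Y (exp_df 1)
      & cvg_in_distribution m2 Z X Y].
Proof.
move=> m2m m20 m2oo ZE.
have [nu nuE] := @linexp_law R 1 0 ler01 (lexx 0) ltac:(lra).
have expE : linexp_df 1 0 = exp_df 1 :> (R -> R).
  by apply/funext => x; rewrite /exp_df /linexp_df !mul0r addr0.
rewrite expE in nuE.
have m2gt0 : \forall m \near \oo, (0 < m2 m)%N by exact: m2oo near_gt0.
have t0 : \forall m \near \oo, 0 < (m2 m)%:R / m%:R :> R.
  by near=> m; rewrite divr_gt0 // ltr0n; near: m; last exact: near_gt0.
apply: (@rare_tie_regime R m2 tie (fun m => (m2 m)%:R / m%:R) nu) => //.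
- by near=> m; apply/andP; split; near: m.
- by move=> x x0; rewrite /exp_df ltNge (ltW x0).
- move=> x x0; have cut := cvg_cutoff x0 t0 m20.
  have -> : 1 - exp_df 1 x = expR (- x).
    by rewrite -expE linexp_dfE max_l // !mul0r addr0 mul1r subKr.
  apply: cvg_red_end_expR => //.
    apply: (@cvg_near_eq _ _ (fun m => (cutoff ((m2 m)%:R / m%:R) x)%:R *
        ((m2 m)%:R / m%:R) * (m2 m)%:R^-1)).
      near=> m; set c := _%:R; field.
      by rewrite !pnatr_eq0 -!lt0n; apply/andP; split; near: m; last exact: near_gt0.
    have inv0 : (m2 m)%:R^-1 @[m --> \oo] --> (0 : R).
      exact: (cvg_comp m2 (fun n => n%:R^-1 : R) m2oo (@cvg_invn R)).
    by rewrite -(mulr0 x); apply: cvgM.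
  by under eq_fun do rewrite mulrAC mulrC.
- by move=> m w; rewrite ZE mulrAC.
Unshelve. all: by end_near. Qed.

Lemma fixed_regime (m2 : nat -> nat) (tie : nat -> seq colour -> colour)
    (k : nat) (Z : nat -> seq colour -> R * R) : (0 < k)%N ->
  (\forall m \near \oo, (m2 m <= m)%N) ->
  (\forall m \near \oo, m2 m = k) ->
  (forall m w, Z m w = ((nonzero_ties w)%:R,
     (sure_guesses (tie m) w)%:R / m%:R)) ->
  exists (disp : measure_display) (Om : measurableType disp)
    (P : probability Om R) (X Y : {RV P >-> R}),
    [/\ independent_pair X Y, forall w : Om, X w = 0, has_df Y (beta1_df k)
      & cvg_in_distribution m2 Z X Y].
Proof.
move=> k0 m2m m2k ZE.
have [nu nuE] := beta1_law R k0.
have inv0 : \forall m \near \oo, 0 < m%:R^-1 :> R.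
  by near=> m; rewrite invr_gt0 ltr0n; near: m; exact: near_gt0.
apply: (@rare_tie_regime R m2 tie (fun m => m%:R^-1) nu) => //.
- near=> m; apply/andP; split; last by near: m.
  by rewrite (_ : m2 m = k) //; near: m.
- apply: cvg_near_eq (cvg_cst_divn k%:R); near=> m.
  by rewrite (_ : m2 m = k) //; near: m.
- by move=> x x0; rewrite /beta1_df (ltW x0).
- move=> x x0; rewrite beta1_dfE // (max_l x0) subKr.
  apply: (@cvg_near_eq _ _ (fun m => black_end R k m (cutoff m%:R^-1 x))).
    by near=> m; rewrite (_ : m2 m = k) //; near: m.
  exact: cvg_red_end_pow (cvg_cutoff x0 inv0 (@cvg_invn R)).
- by move=> m w; rewrite ZE mulrC.
Unshelve. all: by end_near. Qed.

End Scalings.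

Theorem theorem7 (R : realType) (m2 : nat -> nat)
    (tie : nat -> seq colour -> colour)
    (m2_le : \forall m1 \near \oo, (m2 m1 <= m1)%N) :
  let W (w : seq colour) : R := (nonzero_ties w)%:R in
  let T (m1 : nat) (w : seq colour) : R := (sure_guesses (tie m1) w)%:R in
  let M1 (m1 : nat) : R := m1%:R in
  let M2 (m1 : nat) : R := (m2 m1)%:R in
  let D (m1 : nat) : R := m1%:R - (m2 m1)%:R in
  let sqrtM1 (m1 : nat) : R := Num.sqrt m1%:R in
  (* Case (1) *)
  (forall rho : R, 0 < rho -> rho < 1 ->
    M2 ~_\oo (fun m1 => rho * M1 m1) ->
    exists (disp : measure_display) (Om : measurableType disp)
      (P : probability Om R) (X Y : {RV P >-> R}),
      (forall k l : nat, (1 <= l)%N ->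
         joint_pmf X Y k%:R l%:R = limit_pmf rho k l) /\
      cvg_in_distribution m2 (fun m1 w => (W w, T m1 w)) X Y) /\
  (* Case (2) *)
  (forall k : nat, (1 <= k)%N ->
    (\forall m1 \near \oo, m2 m1 = k) ->
    exists (disp : measure_display) (Om : measurableType disp)
      (P : probability Om R) (X Y : {RV P >-> R}),
      independent_pair X Y /\
      (forall w : Om, X w = 0) /\
      has_df Y (beta1_df k) /\
      (* all [U i] are almost surely at most the neutral element 1 *)
      (forall (disp' : measure_display) (Om' : measurableType disp')
         (P' : probability Om' R) (U : 'I_k -> {RV P' >-> R}),
         independent_family U ->
         (forall i (A : set R), measurable A ->
            distribution P' (U i) A = uniform_prob (@ltr01 R) A) ->
         forall y : R,
           P' [set w | \big[Num.min/1]_(i < k) U i w <= y] = cdf Y y) /\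
      cvg_in_distribution m2 (fun m1 w => (W w, T m1 w / M1 m1)) X Y) /\
  (* Case (3) *)
  (M2 =o_\oo M1 -> m2 @ \oo --> \oo ->
    exists (disp : measure_display) (Om : measurableType disp)
      (P : probability Om R) (X Y : {RV P >-> R}),
      independent_pair X Y /\
      (forall w : Om, X w = 0) /\
      has_df Y (exp_df 1) /\
      cvg_in_distribution m2
        (fun m1 w => (W w, M2 m1 * T m1 w / M1 m1)) X Y) /\
  (* Case (4) *)
  (M2 ~_\oo M1 -> sqrtM1 =o_\oo D -> D =o_\oo M1 ->
    exists (disp : measure_display) (Om : measurableType disp)
      (P : probability Om R) (X Y : {RV P >-> R}),
      independent_pair X Y /\
      has_df X (exp_df (1 / 2)) /\
      geometric_law Y (1 / 2) /\
      cvg_in_distribution m2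
        (fun m1 w => (D m1 * W w / M1 m1, T m1 w)) X Y) /\
  (* Case (5) *)
  (forall alpha : R, 0 < alpha ->
    M2 ~_\oo M1 -> D ~_\oo (fun m1 => alpha * sqrtM1 m1) ->
    exists (disp : measure_display) (Om : measurableType disp)
      (P : probability Om R) (X Y : {RV P >-> R}),
      independent_pair X Y /\
      has_df X (linexp_df (alpha / 2) (1 / 2)) /\
      geometric_law Y (1 / 2) /\
      cvg_in_distribution m2
        (fun m1 w => (W w / sqrtM1 m1, T m1 w)) X Y) /\
  (* Case (6) *)
  (M2 ~_\oo M1 -> D =o_\oo sqrtM1 ->
    exists (disp : measure_display) (Om : measurableType disp)
      (P : probability Om R) (X Y : {RV P >-> R}),
      independent_pair X Y /\
      has_df X (rayleigh_df (Num.sqrt 2)) /\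
      geometric_law Y (1 / 2) /\
      cvg_in_distribution m2
        (fun m1 w => (W w / sqrtM1 m1, T m1 w)) X Y).
Proof.
move=> W T M1 M2 D sqrtM1.
have M10 : \forall m \near \oo, M1 m != 0.
  by near=> m; rewrite /M1 pnatr_eq0 -lt0n; near: m; exact: near_gt0.
have sqrtM10 : \forall m \near \oo, sqrtM1 m != 0.
  near=> m; rewrite /sqrtM1 gt_eqF // sqrtr_gt0 ltr0n; near: m.
  exact: near_gt0.
split.
  move=> rho rho0 rho1 /equiv_ratio M2rho.
  apply: (@proportional_regime R m2 tie rho) => //.
  apply: (@cvg_near_eq _ _ (fun m => M2 m / (rho * M1 m) * rho)).
    near=> m; have m0 : M1 m != 0 by near: m.
    by rewrite -/(M1 m) -/(M2 m); field; rewrite m0 gt_eqF.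
  rewrite -[X in _ --> X]mul1r; apply: cvgMl; apply: M2rho.
  by near=> m; apply: mulf_neq0; [rewrite gt_eqF|near: m].
split.
  move=> k k0 m2k.
  have [disp [Om [P [X [Y [XY X0 YF cvgXY]]]]]] :=
    @fixed_regime R m2 tie k _ k0 m2_le m2k (fun _ _ => erefl).
  exists disp, Om, P, X, Y; do 4 split => //.
  by move=> disp' Om' P' U indU unifU y; rewrite YF; exact: min_uniform_df.
split.
  move=> /(littleo_ratio M10) m20 m2oo.
  have [disp [Om [P [X [Y [XY X0 YF cvgXY]]]]]] :=
    @sparse_regime R m2 tie _ m2_le m20 m2oo (fun _ _ => erefl).
  by exists disp, Om, P, X, Y.
split.
  move=> /(equiv_ratio M10) m21 sqrtD /(littleo_ratio M10) Dm.
  have D0 : \forall m \near \oo, D m != 0.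
    have /eqoP/(_ 1 ltr01) sqrt_le := sqrtD.
    near=> m; have : sqrtM1 m != 0 by near: m.
    apply: contraNneq => Dm0; rewrite -normr_le0.
    have : `|sqrtM1 m| <= 1 * `|D m| by near: m.
    by rewrite Dm0 normr0 mulr0.
  have [disp [Om [P [X [Y [XY XF YG cvgXY]]]]]] := @subcritical_regime R m2 tie _
    m2_le m21 D0 (littleo_ratio D0 sqrtD) Dm (fun _ _ => erefl).
  by exists disp, Om, P, X, Y.
split.
  move=> al al0 /(equiv_ratio M10) m21 /equiv_ratio Dal.
  have Dsqrt : D m / sqrtM1 m @[m --> \oo] --> al.
    apply: (@cvg_near_eq _ _ (fun m => D m / (al * sqrtM1 m) * al)).
      near=> m; have m0 : sqrtM1 m != 0 by near: m.
      by field; rewrite m0 gt_eqF.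
    rewrite -[X in _ --> X]mul1r; apply: cvgMl; apply: Dal.
    by near=> m; apply: mulf_neq0; [rewrite gt_eqF|near: m].
  have [disp [Om [P [X [Y [XY XF YG cvgXY]]]]]] := @critical_regime R m2 tie al _
    (ltW al0) m2_le m21 Dsqrt (fun _ _ => erefl).
  by exists disp, Om, P, X, Y.
move=> /(equiv_ratio M10) m21 /(littleo_ratio sqrtM10) Dsqrt.
have [disp [Om [P [X [Y [XY XF YG cvgXY]]]]]] := @critical_regime R m2 tie 0 _
  (lexx 0) m2_le m21 Dsqrt (fun _ _ => erefl).
exists disp, Om, P, X, Y; split => //; split; last by split.
move=> x; rewrite XF /linexp_df /rayleigh_df sqr_sqrtr // !mul0r add0r.
by case: ifP => // _; congr ((1 - expR (- _))%:E); field.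
Unshelve. all: by end_near. Qed.
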